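(* Let $(x^k)_{k\ge 0}$ be a sequence constructed according to Algorithm quADAPT (described in the context), and assume that for every $k\ge 1$ the iterate $x^k$ is a KKT point of the approximate problem $\overline{\mathrm{SIP}}^{k-1}(Y^k)$ and that $\lim_{k\to\infty}x^k=x^*$ for some $x^*\in\mathbb R^n$. Assume that the Reduction Ansatz holds at $x^*$, that for every $i\in I$ there is a $y\in Y$ with $g_i(x^*,y)=0$, and that $\overline I^k=I$ for every $k$. Assume moreover that EMFCQ is satisfied at $x^*$. Then $x^*$ is a stationary point of $\mathrm{SIP}$.
   Context: **Problem.** Let $I,J$ be finite index sets and let $f:\mathbb R^n\to\mathbb R$, $g=(g_i)_{i\in I}:\mathbb R^n\times\mathbb R^m\to\mathbb R^{|I|}$, $v=(v_j)_{j\in J}:\mathbb R^m\to\mathbb R^{|J|}$ be twice continuously differentiable. Let $Y=\{y\in\mathbb R^m: v_j(y)\le 0\ \forall j\in J\}$, assumed compact. $\mathrm{SIP}$ is the problem of minimizing $f(x)$ over $x\in\mathbb R^n$ subject to $g_i(x,y)\le 0$ for all $i\in I$, $y\in Y$; its feasible set is $M$. For $i\in I$, $x\in\mathbb R^n$, the lower-level problem $Q_i(x)$ is to maximize $g_i(x,y)$ over $y\in Y$. Its Lagrange function is $\mathcal L_i(x,y,\mu)=g_i(x,y)-\sum_{j\in J}\mu_j v_j(y)$. $D_1,D_2$ denote derivatives with respect to the first and second (vector) argument; $\|\cdot\|$ is the Euclidean norm. Active indices: $Y_0^i(x)=\{y\in Y: g_i(x,y)=0\}$. **Regularity of lower-level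 points.** A point $y\in Y$ satisfies LICQ if the gradients $Dv_j(y)$, $j\in J$ with $v_j(y)=0$, are linearly independent. It satisfies LICQ, strict complementary slackness and the second-order sufficient condition for $Q_i(x)$ if LICQ holds and there is a (then unique) $\mu\in\mathbb R^{|J|}$ with $D_2\mathcal L_i(x,y,\mu)=0$, $\mu_j\ge0$, $\mu_jv_j(y)=0$ for all $j\in J$, such that for each $j$ exactly one of $\mu_j$, $v_j(y)$ is zero, and $d^\top D_2^2\mathcal L_i(x,y,\mu)d<0$ for all $d\in\mathbb R^m\setminus\{0\}$ with $Dv_j(y)d=0$ for all $j$ with $\mu_j>0$. The Reduction Ansatz holds at $x$ if, for every $i\in I$, every $y\in Y_0^i(x)$ satisfies LICQ, strict complementary slackness and the second-order sufficient condition for $Q_i(x)$. **Algorithm quADAPT.** Input: $x^0\in\mathbb R^n$ and a finite set $Y^0\subseteq Y$. In iteration $k=0,1,2,\dots$: for each $i\in I$ compute a global solution $y^{i,k}$ of $Q_i(x^k)$ with Lagrange multipliers $\mu^{i,k}$ satisfying the KKT conditions. Let $\overline I^k$ be the set of $i\in I$ for which $y^{i,k}$ satisfies LICQ, strict complementary slackness and the second-order sufficient condition for $Q_i(x^k)$. For $i\in\overline I^k$ the implicit function theorem gives, near $x^k$, continuously differentiable functions $y^i(\cdot),\mu^i(\cdot)$ with $y^i(x^k)=y^{i,k}$, $\mu^i(x^k)=\mu^{i,k}$, such that $y^i(x)$ is the locally unique stationary (KKT) point of $Q_i(x)$ near $y^{i,k}$ and $\mu^i(x)$ is its multiplier vector.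 Put $\overline y^{i,k}(x)=y^{i,k}+Dy^i(x^k)(x-x^k)$, $\overline\mu^{i,k}(x)=\mu^{i,k}+D\mu^i(x^k)(x-x^k)$ and $\overline g_i^k(x)=\mathcal L_i(x,\overline y^{i,k}(x),\overline\mu^{i,k}(x))$. Set $Y^{k+1}=Y^k\cup\bigcup_{i\in I}\{y^{i,k}\}$ and let $x^{k+1}$ be a solution (here: KKT point) of the finite problem $\overline{\mathrm{SIP}}^k(Y^{k+1})$: minimize $f(x)$ over $x\in\mathbb R^n$ subject to $g_i(x,y)\le0$ for all $i\in I$, $y\in Y^{k+1}$, and $\overline g_i^k(x)\le 0$ for all $i\in\overline I^k$. A KKT point is feasible and admits nonnegative Lagrange multipliers satisfying the usual stationarity and complementarity conditions. **EMFCQ** at $x$: there is $\xi\in\mathbb R^n$ with $D_1g_i(x,y)\xi\le-1$ for every $i\in I$, $y\in Y_0^i(x)$. **Stationary point of SIP.** A feasible point $x\in M$ at which the Reduction Ansatz holds (then each $Y_0^i(x)$ is finite) is a stationary point of $\mathrm{SIP}$ if there are $\lambda_{i,y}\ge 0$ ($i\in I$, $y\in Y_0^i(x)$) with $0=Df(x)+\sum_{i\in I}\sum_{y\in Y_0^i(x)}\lambda_{i,y}D_1g_i(x,y)$. *)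

(* Defs.v *)
From HB Require Import structures.
From mathcomp Require Import all_boot all_order all_algebra.
From mathcomp Require Import all_classical all_reals all_analysis.

Set Implicit Arguments.
Unset Strict Implicit.
Unset Printing Implicit Defensive.
Import Order.TTheory GRing.Theory Num.Theory.
Import numFieldNormedType.Exports.
Local Open Scope classical_set_scope.
Local Open Scope ring_scope.

Section Smoothness.
Context {R : realType}.

(* All domains below are finite-dimensional, so continuity of the derivative is
   the same as continuity of each of its evaluations z |-> 'd F z h. *)
Definition C1_on {V W : normedModType R} (U : set V) (F : V -> W) : Prop :=
  forall z, U z ->
    differentiable F z /\ forall h, {for z, continuous (fun w => 'd F w h)}.

Definition C2 {V W : normedModType R} (F : V -> W) : Prop :=
  C1_on setT F /\ forall h, C1_on setT (fun w => 'd F w h).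

Definition grad {p : nat} (F : 'rV[R]_p -> R) (z : 'rV[R]_p) : 'rV[R]_p :=
  \row_a 'd F z (delta_mx 0 a).

Definition hessian {p : nat} (F : 'rV[R]_p -> R) (z : 'rV[R]_p) : 'M[R]_p :=
  \matrix_(a, b) 'd (fun w => 'd F w (delta_mx 0 a)) z (delta_mx 0 b).

End Smoothness.

Section SemiInfinite.
Context {R : realType} {I J : finType} {n m : nat}.
Variables (f : 'rV[R]_n -> R) (g : I -> 'rV[R]_n * 'rV[R]_m -> R).
Variable v : J -> 'rV[R]_m -> R.

Definition index_set : set 'rV[R]_m := [set y | forall j, v j y <= 0].

Definition feasible (x : 'rV[R]_n) : Prop :=
  forall i y, index_set y -> g i (x, y) <= 0.

Definition active_indices (i : I) (x : 'rV[R]_n) : set 'rV[R]_m :=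
  [set y | index_set y /\ g i (x, y) = 0].

Definition lagrangian (i : I) (x : 'rV[R]_n) (y : 'rV[R]_m) (mu : J -> R) : R :=
  g i (x, y) - \sum_j mu j * v j y.

Definition global_solution (i : I) (x : 'rV[R]_n) (y : 'rV[R]_m) : Prop :=
  index_set y /\ forall z, index_set z -> g i (x, z) <= g i (x, y).

Definition lower_KKT (i : I) (x : 'rV[R]_n) (y : 'rV[R]_m) (mu : J -> R) :
    Prop :=
  [/\ index_set y,
      grad (fun z => lagrangian i x z mu) y = 0,
      forall j, 0 <= mu j
    & forall j, mu j * v j y = 0].

Definition LICQ (y : 'rV[R]_m) : Prop :=
  free [seq grad (v j) y | j <- enum J & v j y == 0].

Definition strict_complementarity (y : 'rV[R]_m) (mu : J -> R) : Prop :=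
  forall j, (mu j == 0) (+) (v j y == 0).

Definition second_order_sufficient (i : I) (x : 'rV[R]_n) (y : 'rV[R]_m)
    (mu : J -> R) : Prop :=
  forall d : 'rV[R]_m, d != 0 ->
    (forall j, 0 < mu j -> 'd (v j) y d = 0) ->
    (d *m hessian (fun z => lagrangian i x z mu) y *m d^T) 0 0 < 0.

Definition regular_point (i : I) (x : 'rV[R]_n) (y : 'rV[R]_m) : Prop :=
  [/\ index_set y, LICQ y &
      exists mu, [/\ lower_KKT i x y mu, strict_complementarity y mu
                   & second_order_sufficient i x y mu]].

Definition reduction_ansatz (x : 'rV[R]_n) : Prop :=
  forall i y, active_indices i x y -> regular_point i x y.

Definition EMFCQ (x : 'rV[R]_n) : Prop :=
  exists xi : 'rV[R]_n, forall i y, active_indices i x y ->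
    'd (fun z => g i (z, y)) x xi <= -1.

(* \sum_(y \in A) is 0 by convention when infinitely many terms are nonzero; this
   does not occur here, because the reduction ansatz and compactness of the index
   set make active_indices i x finite. *)
Definition stationary_point (x : 'rV[R]_n) : Prop :=
  [/\ feasible x, reduction_ansatz x &
      exists lambda : I -> 'rV[R]_m -> R,
        (forall i y, active_indices i x y -> 0 <= lambda i y) /\
        0 = grad f x
            + \sum_i \sum_(y \in active_indices i x)
                lambda i y *: grad (fun z => g i (z, y)) x].

(* yf and muf are the implicit functions near x0: yf x is the only KKT point of
   the lower-level problem at x that lies near y0, and muf x is its only
   multiplier. *)
Definition implicit_KKT (i : I) (x0 : 'rV[R]_n) (y0 : 'rV[R]_m) (mu0 : J -> R)
    (yf : 'rV[R]_n -> 'rV[R]_m) (muf : 'rV[R]_n -> J -> R) : Prop :=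
  [/\ yf x0 = y0, muf x0 =1 mu0 &
      exists (U : set 'rV[R]_n) (V : set 'rV[R]_m),
        [/\ open_nbhs x0 U, open_nbhs y0 V,
            C1_on U yf, forall j, C1_on U (fun x => muf x j)
          & forall x, U x ->
              [/\ V (yf x), lower_KKT i x (yf x) (muf x)
                & forall y mu, V y -> lower_KKT i x y mu ->
                    y = yf x /\ mu =1 muf x]]].

Section Algorithm.
Variables (x : nat -> 'rV[R]_n) (Yd : nat -> set 'rV[R]_m).
Variables (y : I -> nat -> 'rV[R]_m) (mu : I -> nat -> J -> R).
Variables (yf : I -> nat -> 'rV[R]_n -> 'rV[R]_m).
Variables (muf : I -> nat -> 'rV[R]_n -> J -> R).

Definition Ibar (k : nat) : set I := [set i | regular_point i (x k) (y i k)].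

Definition ybar (i : I) (k : nat) (z : 'rV[R]_n) : 'rV[R]_m :=
  y i k + 'd (yf i k) (x k) (z - x k).

Definition mubar (i : I) (k : nat) (z : 'rV[R]_n) (j : J) : R :=
  mu i k j + 'd (fun w => muf i k w j) (x k) (z - x k).

Definition gbar (i : I) (k : nat) (z : 'rV[R]_n) : R :=
  lagrangian i z (ybar i k z) (mubar i k z).

Definition approx_feasible (k : nat) (z : 'rV[R]_n) : Prop :=
  (forall i w, Yd k.+1 w -> g i (z, w) <= 0) /\
  (forall i, Ibar k i -> gbar i k z <= 0).

(* KKT points of the finite problem built in iteration k from Yd k.+1; the sets
   Yd k.+1 and Ibar k are finite. *)
Definition approx_KKT (k : nat) (z : 'rV[R]_n) : Prop :=
  approx_feasible k z /\
  exists (alpha : I -> 'rV[R]_m -> R) (beta : I -> R),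
    [/\ forall i w, Yd k.+1 w -> 0 <= alpha i w /\ alpha i w * g i (z, w) = 0,
        forall i, Ibar k i -> 0 <= beta i /\ beta i * gbar i k z = 0
      & 0 = grad f z
            + \sum_i \sum_(w \in Yd k.+1)
                alpha i w *: grad (fun u => g i (u, w)) z
            + \sum_(i \in Ibar k) beta i *: grad (gbar i k) z].

Record quADAPT : Prop := {
  quADAPT_finite0 : finite_set (Yd 0);
  quADAPT_sub0 : Yd 0 `<=` index_set;
  quADAPT_lower : forall i k, global_solution i (x k) (y i k);
  quADAPT_multiplier : forall i k, lower_KKT i (x k) (y i k) (mu i k);
  quADAPT_implicit : forall i k, Ibar k i ->
    implicit_KKT i (x k) (y i k) (mu i k) (yf i k) (muf i k);
  quADAPT_update : forall k, Yd k.+1 = Yd k `|` range (fun i => y i k);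
  quADAPT_next : forall k, approx_KKT k (x k.+1)
}.

End Algorithm.
End SemiInfinite.

(* Main.v *)
Require Import Defs.
From HB Require Import structures.
From mathcomp Require Import all_boot all_order all_algebra.
From mathcomp Require Import all_classical all_reals all_analysis.
From mathcomp Require Import ring lra.
Import Order.TTheory GRing.Theory Num.Theory.
Import numFieldNormedType.Exports.
Local Open Scope classical_set_scope.
Local Open Scope ring_scope.

Set Implicit Arguments.
Unset Strict Implicit.
Unset Printing Implicit Defensive.

(** Write D_1 and D_2 for the differentials in the first and the second argument.

    The multipliers of the finite problems need not be followed to the limit.
    By Farkas' lemma, stationarity of the limit point can only fail if there is
    a direction [eta] along which [f] decreases to first order while
    D_1 g_i(xs, w) [eta] <= 0 for every active index [w] ([stationary_or_descent]).
    A small multiple of the EMFCQ direction makes all these inequalities strict.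
    Strict inequalities survive at late iterates, provided that the constraints of
    the finite problem that carry a multiplier there have differentials close to
    those of the active constraints at the limit.  Pairing the KKT equation of that
    finite problem with the perturbed direction then gives 0 = negative number
    ([approx_KKT_descent]), a contradiction.

    Two kinds of constraints carry multipliers.  For g_i(., w) <= 0 with [w] in the
    discretization, complementarity makes [w] active at the iterate, and compactness
    of the index set is enough ([active_descent_near]).  For the constraint
    [gbar i k <= 0] one has to show that its differential at the next iterate tends to
    D_1 g_i(xs, ys), where [ys] is a limit of the global solutions [y i k]
    ([gbar_diff_cvg]).  By the chain rule ([diff_gbar]) that differential is D_1 g_i
    plus the implicit derivatives of [y] and [mu] multiplied by quantities which tend
    to 0: the partial derivatives of the Lagrange function, and the constraint
    values [v j].  So it suffices that the implicit derivatives stay bounded.  They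
    solve the linearized KKT system, whose matrix at [ys] is injective by LICQ, strict
    complementarity and the second-order condition ([kkt_injective]), and injectivity
    comes with a bound on solutions that is uniform for nearby matrices
    ([perturbed_injective_bound]).  The same bound proves convergence of the
    multipliers [mu i k], hence that the set of active lower-level constraints is
    eventually constant ([active_set_stable]), and also that active indices are isolated
    ([active_index_isolated]), so that Farkas' lemma meets only finitely many vectors.

    All limits are taken along one ultrafilter on [nat] finer than the usual one: along
    it, every sequence in a compact set converges, and no subsequences are needed. *)

(** * Farkas' lemma *)

Section Farkas.
Context {R : realFieldType} {n : nat}.
Implicit Types u w : 'rV[R]_n.

(** The entries of [grad] are the values of the differential on the unit vectors, so
    pairing with a gradient in this sense gives back the differential ([dot_grad]). *)
Definition dot u w : R := \sum_a u 0 a * w 0 a.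

Lemma dotC u w : dot u w = dot w u.
Proof. by apply: eq_bigr => a _; rewrite mulrC. Qed.

Lemma dot_is_linear w : linear (dot w : 'rV[R]_n -> R^o).
Proof.
move=> c u1 u2; rewrite /dot scaler_sumr -big_split /=; apply: eq_bigr => a _.
by rewrite !mxE mulrDr mulrCA.
Qed.
HB.instance Definition _ w :=
  GRing.isLinear.Build R 'rV[R]_n R^o _ (dot w) (dot_is_linear w).

Lemma dotDr w u1 u2 : dot w (u1 + u2) = dot w u1 + dot w u2.
Proof. exact: linearD. Qed.
Lemma dotZr w c u : dot w (c *: u) = c * dot w u.
Proof. exact: linearZ. Qed.
Lemma dotBr w u1 u2 : dot w (u1 - u2) = dot w u1 - dot w u2.
Proof. exact: linearB. Qed.
Lemma dotDl w u1 u2 : dot (u1 + u2) w = dot u1 w + dot u2 w.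
Proof. by rewrite dotC dotDr !(dotC w). Qed.
Lemma dotBl w u1 u2 : dot (u1 - u2) w = dot u1 w - dot u2 w.
Proof. by rewrite dotC dotBr !(dotC w). Qed.
Lemma dotZl w c u : dot (c *: u) w = c * dot u w.
Proof. by rewrite dotC dotZr dotC. Qed.

(** Induction on the number of vectors.  If the separating direction [eta] of the
    first vectors fails for a new vector, everything is projected along the new vector
    onto the hyperplane orthogonal to [eta], and the induction hypothesis is applied to
    the projections: a conic representation lifts because the coefficient it leaves on
    the new vector is nonnegative, and a separating direction lifts after a correction
    by a multiple of [eta]. *)
Lemma farkas (T : eqType) (s : seq T) (a : T -> 'rV[R]_n) (b : 'rV[R]_n) :
  uniq s ->
  (exists lambda : T -> R, (forall t, 0 <= lambda t) /\
     b = \sum_(t <- s) lambda t *: a t) \/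
  (exists eta, (forall t, t \in s -> dot (a t) eta <= 0) /\ 0 < dot b eta).
Proof.
elim: s a b => [|t0 s IH] a b.
  move=> _; have [->|b0] := eqVneq b 0.
    by left; exists (fun=> 0); split => //; rewrite big_nil.
  right; exists b; split => //.
  rewrite /dot lt_neqAle; apply/andP; split; last first.
    by apply: sumr_ge0 => i _; rewrite -expr2 sqr_ge0.
  apply: contra b0; rewrite eq_sym psumr_eq0; last first.
    by move=> i _; rewrite -expr2 sqr_ge0.
  move=> /allP b0; apply/eqP/rowP => i; rewrite mxE.
  by have := b0 i (mem_index_enum i); rewrite mulf_eq0 orbb => /eqP.
rewrite cons_uniq => /andP[t0s us].
have extend (c : R) (lam : T -> R) : 0 <= c -> (forall t, 0 <= lam t) ->
    b = c *: a t0 + \sum_(t <- s) lam t *: a t ->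
    exists lambda : T -> R, (forall t, 0 <= lambda t) /\
     b = \sum_(t <- t0 :: s) lambda t *: a t.
  move=> c0 lam0 ->; exists (fun t => if t == t0 then c else lam t); split.
    by move=> t; case: ifP.
  rewrite big_cons eqxx; congr (_ + _); apply: eq_big_seq => t ts.
  by case: eqP => // tt0; rewrite -tt0 ts in t0s.
have [[lam [lam0 bE]]|[eta [aeta beta]]] := IH a b us.
  by left; apply: (extend 0 lam) => //; rewrite scale0r add0r.
have [a0eta|a0eta] := leP (dot (a t0) eta) 0.
  right; exists eta; split => // t; rewrite inE => /predU1P[->//|]; exact: aeta.
set al := dot (a t0) eta in a0eta.
(* project along [a t0] onto the hyperplane orthogonal to [eta] *)
pose p w := w - (dot w eta / al) *: a t0.
have [[lam [lam0 bE]]|[zeta [azeta bzeta]]] := IH (p \o a) (p b) us.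
  left; apply: (extend (dot b eta / al
                        - \sum_(t <- s) lam t * (dot (a t) eta / al)) lam) => //.
    rewrite subr_ge0; apply: (@le_trans _ _ 0); last first.
      by apply: divr_ge0; exact: ltW.
    rewrite big_seq; apply: sumr_le0 => t ts; apply: mulr_ge0_le0 => //.
    by rewrite ler_pdivrMr// mul0r aeta.
  move/eqP: bE; rewrite {1}/p subr_eq => /eqP {1}->.
  rewrite scalerBl addrC -addrA; congr (_ + _); rewrite addrC.
  rewrite scaler_suml -sumrB; apply: eq_bigr => t _ /=.
  by rewrite scalerBr scalerA.
right; exists (zeta - (dot (a t0) zeta / al) *: eta).
have pE w : dot w (zeta - (dot (a t0) zeta / al) *: eta) = dot (p w) zeta.
  rewrite /p dotBl dotBr dotZl dotZr.
  by rewrite mulrAC [in RHS]mulrAC (mulrC (dot w eta)).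
split=> [t|]; rewrite pE //.
rewrite inE => /predU1P[->|]; last exact: azeta.
by rewrite /p -/al divff ?gt_eqF// scale1r subrr /dot big1// => i _; rewrite mxE mul0r.
Qed.

End Farkas.

(** * Perturbation of injective linear systems *)

Lemma cvg_fsum {R : realType} {K : Type} {F : set_system K} {FF : Filter F}
    {T : finType} (P : pred T) (f : T -> K -> R) (l : T -> R) :
  (forall t, P t -> f t k @[k --> F] --> l t) ->
  (\sum_(t | P t) f t k) @[k --> F] --> \sum_(t | P t) l t.
Proof.
by move=> fl; apply: cvg_big => //; exact: add_continuous.
Qed.

Section Perturbation.
Context {R : realType} {S T : finType}.

Lemma injective_left_inverse (A : T -> S -> R) :
  (forall u : S -> R, (forall t, \sum_s A t s * u s = 0) -> forall s, u s = 0) ->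
  exists B : S -> T -> R, forall s s', \sum_t B s t * A t s' = (s == s')%:R.
Proof.
move=> injA; pose M := \matrix_(i < #|S|, j < #|T|) A (enum_val j) (enum_val i).
have /row_freeP[B MB] : row_free M.
  apply: inj_row_free => w wM; apply/rowP => i; rewrite mxE.
  rewrite -(enum_valK i); apply: (injA (fun s => w 0 (enum_rank s))) => t.
  have := congr1 (fun X : 'rV_#|T| => X 0 (enum_rank t)) wM; rewrite !mxE => wMt.
  rewrite -[RHS]wMt.
  rewrite (reindex (enum_val : 'I_#|S| -> S)) /=; last first.
    by apply: onW_bij; exact: enum_val_bij.
  by apply: eq_bigr => j _; rewrite !mxE enum_rankK enum_valK mulrC.
exists (fun s t => B (enum_rank t) (enum_rank s)) => s s'.
have := congr1 (fun X : 'M[R]_(#|S|, #|S|) => X (enum_rank s') (enum_rank s)) MB.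
rewrite !mxE (inj_eq enum_rank_inj) eq_sym => MBs; rewrite -[RHS]MBs.
rewrite (reindex (enum_val : 'I_#|T| -> T)) /=; last first.
  by apply: onW_bij; exact: enum_val_bij.
by apply: eq_bigr => j _; rewrite !mxE enum_rankK enum_valK mulrC.
Qed.

(** With a left inverse B of the limit matrix A one has
    u = B (a k u) + B (A - a k) u, and the last term is at most half of u as soon as
    a k is close enough to A.  The bound is uniform in [u], which may depend on [k]. *)
Lemma perturbed_injective_bound {K : Type} {F : set_system K} {FF : Filter F}
    (A : T -> S -> R) (a : K -> T -> S -> R) :
  (forall u : S -> R, (forall t, \sum_s A t s * u s = 0) -> forall s, u s = 0) ->
  (forall t s, a k t s @[k --> F] --> A t s) ->
  exists2 C : R, 0 <= C & \forall k \near F, forall u : S -> R,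
    \sum_s `|u s| <= C * \sum_t `|\sum_s a k t s * u s|.
Proof.
move=> /injective_left_inverse[B BA] aA.
pose b := \sum_s \sum_t `|B s t|.
have b0 : 0 <= b by apply: sumr_ge0 => s _; apply: sumr_ge0.
exists (2 * b); first by rewrite mulr_ge0.
pose e k := \sum_s \sum_t \sum_s' `|B s t| * `|A t s' - a k t s'|.
have e0 : e k @[k --> F] --> (0 : R).
  rewrite (_ : 0 = \sum_(s : S) \sum_(t : T) \sum_(s' : S)
    `|B s t| * `|A t s' - A t s'|); last first.
    by rewrite big1// => s _; rewrite big1// => t _; rewrite big1// => s' _;
       rewrite subrr normr0 mulr0.
  apply: cvg_fsum => s _; apply: cvg_fsum => t _; apply: cvg_fsum => s' _.
  apply: cvgMl_tmp; apply: cvg_norm; apply: cvgB; [exact: cvg_cst|exact: aA].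
have : \forall k \near F, e k < 1/2.
  by apply: (cvgr_lt _ e0); rewrite divr_gt0.
apply: filterS => k ek u.
set N := \sum_s `|u s|; pose r t := \sum_s a k t s * u s.
have N0 : 0 <= N by apply: sumr_ge0.
have uN s : `|u s| <= N.
  by rewrite /N (bigD1 s)//= lerDl; apply: sumr_ge0.
have uE s : u s = \sum_t B s t * r t + \sum_t \sum_s' B s t * (A t s' - a k t s') * u s'.
  rewrite -big_split /=.
  transitivity (\sum_s' (s == s')%:R * u s').
    rewrite (bigD1 s)//= eqxx mul1r big1 ?addr0// => s' /negbTE.
    by rewrite eq_sym => ->; rewrite mul0r.
  rewrite (eq_bigr (fun s' => \sum_t B s t * A t s' * u s')); last first.
    by move=> s' _; rewrite -mulr_suml BA.
  rewrite exchange_big /=; apply: eq_bigr => t _.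
  rewrite /r mulr_sumr -big_split /=; apply: eq_bigr => s' _; ring.
have NE : N <= b * (\sum_t `|r t|) + e k * N.
  rewrite /b /e !mulr_suml -big_split /=; apply: ler_sum => s _.
  rewrite {1}uE (le_trans (ler_normD _ _))// lerD//.
    rewrite mulr_suml (le_trans (ler_norm_sum _ _ _))//; apply: ler_sum => t _.
    by rewrite normrM ler_wpM2l// (bigD1 t)//= lerDl; apply: sumr_ge0.
  rewrite mulr_suml (le_trans (ler_norm_sum _ _ _))//; apply: ler_sum => t _.
  rewrite mulr_suml (le_trans (ler_norm_sum _ _ _))//; apply: ler_sum => s' _.
  by rewrite !normrM ler_wpM2l ?mulr_ge0.
have : e k * N <= 1/2 * N by rewrite ler_wpM2r// ltW.
rewrite -(mulrA 2); move: NE; rewrite /r.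
move: (b * _) (e k * N) => X Y NE YN; lra.
Qed.

End Perturbation.

(** Brings linear independence of a filtered list of vectors into the form of a
    statement about coefficients indexed by all of [J]. *)
Lemma free_filter_enum {R : fieldType} {V : vectType R} {J : finType}
    (w : J -> V) (P : pred J) (e : J -> R) :
  free [seq w j | j <- enum J & P j] ->
  (forall j, ~~ P j -> e j = 0) -> \sum_j e j *: w j = 0 ->
  forall j, e j = 0.
Proof.
move=> fr eP se j; have [Pj|] := boolP (P j); last exact: eP.
move: fr; set s := [seq j <- enum J | P j] => fr.
have js : j \in s by rewrite mem_filter Pj mem_enum.
have js' : (index j s < size (map w s))%N by rewrite size_map index_mem.
have /freeP : free (in_tuple (map w s)) by [].
move=> /(_ (fun i => e (nth j s i)) _ (Ordinal js')) /=.
rewrite nth_index//; apply.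
rewrite -[RHS]se [RHS](bigID P)/= [X in _ = _ + X]big1 ?addr0; last first.
  by move=> i /eP ->; rewrite scale0r.
have -> : \sum_(j | P j) e j *: w j = \sum_(j <- s) e j *: w j.
  by rewrite big_filter big_enum_cond; apply: eq_bigl => i; rewrite andTb.
rewrite (big_nth j) big_mkord.
rewrite -(size_map w).
by apply: eq_bigr => i _; rewrite (nth_map j)// -(size_map w).
Qed.

(** * Differential calculus along filters *)

Section Differentials.
Context {R : realType}.

Lemma diff_row_sum {p : nat} (F : 'rV[R]_p -> R) z h :
  'd F z h = \sum_a h 0 a * 'd F z (delta_mx 0 a).
Proof.
rewrite {1}(row_sum_delta h) linear_sum; apply: eq_bigr => a _.
by rewrite linearZ.
Qed.

Lemma diff_pair_sum {p q : nat} (F : 'rV[R]_p * 'rV[R]_q -> R) z h1 h2 :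
  'd F z (h1, h2) = 'd F z (h1, 0) + 'd F z (0, h2).
Proof. by rewrite -linearD /=; congr ('d F z (_, _)); rewrite ?addr0 ?add0r. Qed.

Lemma diff_pair_suml {p q : nat} (F : 'rV[R]_p * 'rV[R]_q -> R) z h :
  'd F z (h, 0) = \sum_a h 0 a * 'd F z (delta_mx 0 a, 0).
Proof.
pose L := fun h : 'rV[R]_p => 'd F z (h, 0).
have LE : linear L.
  move=> c u w; rewrite /L -linearP; congr ('d F z (_, _)).
  by rewrite /= scaler0 add0r.
pose L' : {linear 'rV[R]_p -> R} := HB.pack L (GRing.isLinear.Build _ _ _ _ L LE).
transitivity (L' h); first by [].
rewrite {1}(row_sum_delta h) linear_sum.
by apply: eq_bigr => a _; rewrite linearZ.
Qed.

Lemma diff_pair_sumr {p q : nat} (F : 'rV[R]_p * 'rV[R]_q -> R) z h :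
  'd F z (0, h) = \sum_a h 0 a * 'd F z (0, delta_mx 0 a).
Proof.
pose L := fun h : 'rV[R]_q => 'd F z (0, h).
have LE : linear L.
  move=> c u w; rewrite /L -linearP; congr ('d F z (_, _)).
  by rewrite /= scaler0 add0r.
pose L' : {linear 'rV[R]_q -> R} := HB.pack L (GRing.isLinear.Build _ _ _ _ L LE).
transitivity (L' h); first by [].
rewrite {1}(row_sum_delta h) linear_sum.
by apply: eq_bigr => a _; rewrite linearZ.
Qed.

Context {K : Type} {G : set_system K} {FG : Filter G}.

Lemma cvg_congr (u w : K -> R) (l l' : R) :
  u =1 w -> l = l' -> w @ G --> l' -> u @ G --> l.
Proof. by move=> /funext -> ->. Qed.

Lemma cvg_coord {p : nat} (h : K -> 'rV[R]_p) (h0 : 'rV[R]_p) a :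
  h @ G --> h0 -> h k 0 a @[k --> G] --> h0 0 a.
Proof. move=> hh.
exact: (@continuous_cvg _ _ _ G FG h (fun M : 'rV[R]_p => M 0 a) h0
  (@coord_continuous R 1 p 0 a h0) hh).
Qed.

(** Continuity of every evaluation of the differential gives joint continuity in the
    point and the direction, by expanding the direction in the standard basis. *)
Lemma diff_cvg {p : nat} (F : 'rV[R]_p -> R) (z h : K -> 'rV[R]_p) (z0 h0 : 'rV[R]_p) :
  C1_on setT F -> z @ G --> z0 -> h @ G --> h0 ->
  'd F (z k) (h k) @[k --> G] --> 'd F z0 h0.
Proof.
move=> CF zz hh; apply: (cvg_congr (fun k => diff_row_sum F (z k) (h k)) (diff_row_sum F z0 h0)).
apply: cvg_fsum => a _; apply: cvgM; first exact: cvg_coord.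
by have [_ c] := CF z0 I; exact: (continuous_cvg _ (c _) zz).
Qed.

Lemma diff_pair_cvg {p q : nat} (F : 'rV[R]_p * 'rV[R]_q -> R)
    (z h1 : K -> 'rV[R]_p) (w h2 : K -> 'rV[R]_q) (z0 h01 : 'rV[R]_p) (w0 h02 : 'rV[R]_q) :
  C1_on setT F -> z @ G --> z0 -> w @ G --> w0 -> h1 @ G --> h01 -> h2 @ G --> h02 ->
  'd F (z k, w k) (h1 k, h2 k) @[k --> G] --> 'd F (z0, w0) (h01, h02).
Proof.
move=> CF zz ww hh1 hh2;
apply: (cvg_congr (fun k => diff_pair_sum F (z k, w k) (h1 k) (h2 k)) (diff_pair_sum F _ _ _)).
have dF h : 'd F (z k, w k) h @[k --> G] --> 'd F (z0, w0) h.
  have [_ /(_ h) c] := CF (z0, w0) I.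
  exact: (continuous_cvg _ c (cvg_pair zz ww)).
apply: cvgD.
  apply: (cvg_congr (fun k => diff_pair_suml F (z k, w k) (h1 k)) (diff_pair_suml F _ _)).
  by apply: cvg_fsum => a _; apply: cvgM; [exact: cvg_coord|exact: dF].
apply: (cvg_congr (fun k => diff_pair_sumr F (z k, w k) (h2 k)) (diff_pair_sumr F _ _)).
by apply: cvg_fsum => a _; apply: cvgM; [exact: cvg_coord|exact: dF].
Qed.

Lemma C1_cvg {p : nat} (F : 'rV[R]_p -> R) (z : K -> 'rV[R]_p) (z0 : 'rV[R]_p) :
  C1_on setT F -> z @ G --> z0 -> F (z k) @[k --> G] --> F z0.
Proof.
move=> CF zz; have [d _] := CF z0 I.
exact: (continuous_cvg _ (differentiable_continuous d) zz).
Qed.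

Lemma C1_pair_cvg {p q : nat} (F : 'rV[R]_p * 'rV[R]_q -> R)
    (z : K -> 'rV[R]_p) (w : K -> 'rV[R]_q) (z0 : 'rV[R]_p) (w0 : 'rV[R]_q) :
  C1_on setT F -> z @ G --> z0 -> w @ G --> w0 -> F (z k, w k) @[k --> G] --> F (z0, w0).
Proof.
move=> CF zz ww; have [d _] := CF (z0, w0) I.
exact: (continuous_cvg _ (differentiable_continuous d) (cvg_pair zz ww)).
Qed.

(** The form in which bounded implicit derivatives are used. *)
Lemma bounded_mul_cvg0 (C : R) (u w : K -> R) :
  (\forall k \near G, `|u k| <= C) -> w @ G --> 0 -> u k * w k @[k --> G] --> 0.
Proof.
move=> uC w0; apply: norm_cvg0.
have Cw : (C * `|w k|) @[k --> G] --> (0 : R).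
  rewrite -[X in _ --> X](mulr0 C) -(normr0 R).
  by apply: cvgMl_tmp; exact: cvg_norm.
apply: (squeeze_cvgr _ (@cvg_cst _ 0 K G _) Cw).
by apply: filterS uC => k uk; rewrite normr_ge0 normrM ler_wpM2r.
Qed.

End Differentials.

Section IsDiff.
Context {R : realType}.

Lemma is_diff_fsum {V : normedModType R} {J : finType} (f df : J -> V -> R) (x : V) :
  (forall j, is_diff x (f j) (df j)) ->
  is_diff x (fun z => \sum_j f j z) (fun h => \sum_j df j h).
Proof.
move=> fd.
suff [d e] : differentiable (fun z => \sum_j f j z) x /\
    'd (fun z => \sum_j f j z) x = (fun h => \sum_j df j h) :> (V -> R).
  exact: DiffDef.
elim: (index_enum J) => [|j s [d e]].
  split.
    by under eq_fun do rewrite big_nil; exact: differentiable_cst.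
  rewrite (_ : (fun z => _) = cst 0); last by apply/funext => z; rewrite big_nil.
  by rewrite diff_cst; apply/funext => h; rewrite big_nil.
have -> : (fun z => \sum_(i <- j :: s) f i z) = f j + (fun z => \sum_(i <- s) f i z).
  by apply/funext => z; rewrite big_cons.
split; first exact: differentiableD.
rewrite diffD// e; apply/funext => h; rewrite big_cons /=.
by have [_ ->] := fd j.
Qed.

Lemma is_diff_pair_comp {U : normedModType R} {p q : nat}
    (F : 'rV[R]_p * 'rV[R]_q -> R) (a da : U -> 'rV[R]_p) (b db : U -> 'rV[R]_q) x :
  differentiable F (a x, b x) -> is_diff x a da -> is_diff x b db ->
  is_diff x (fun z => F (a z, b z)) (fun h => 'd F (a x, b x) (da h, db h)).
Proof.
move=> dF ia ib.
pose c := fun z => (a z, b z).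
have ic : is_diff x c (fun h => (da h, db h)) by exact: is_diff_pair.
have iF : is_diff (c x) F ('d F (c x)) by exact: DiffDef.
exact: (@is_diff_comp _ _ _ _ c _ F _ x ic iF).
Qed.

Lemma is_diff_row_comp {U W : normedModType R}
    (F : W -> R) (b db : U -> W) x :
  differentiable F (b x) -> is_diff x b db ->
  is_diff x (fun z => F (b z)) (fun h => 'd F (b x) (db h)).
Proof.
move=> dF ib.
have iF : is_diff (b x) F ('d F (b x)) by exact: DiffDef.
exact: (@is_diff_comp _ _ _ _ b _ F _ x ib iF).
Qed.

Lemma diff_partial1 {p q : nat} (F : 'rV[R]_p * 'rV[R]_q -> R) x w h :
  differentiable F (x, w) -> 'd (fun z => F (z, w)) x h = 'd F (x, w) (h, 0).
Proof.
move=> dF; have idx := is_diff_id x.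
by have [_ ->] := is_diff_pair_comp (a := id) dF idx (is_diff_cst w x).
Qed.

Lemma dot_grad {p : nat} (F : 'rV[R]_p -> R) z h : dot (grad F z) h = 'd F z h.
Proof.
by rewrite diff_row_sum /dot; apply: eq_bigr => a _; rewrite mxE mulrC.
Qed.

End IsDiff.

Section FirstOrder.
Context {R : realType} {V : normedModType R}.

Lemma differentiable_estimate (F : V -> R) x : differentiable F x ->
  forall e, 0 < e ->
  \forall z \near x, `|'d F x (z - x) - (F z - F x)| <= e * `|z - x|.
Proof.
move=> dF e e0.
have /eqaddoP/(_ e e0) := (diff_locally dF).
rewrite (near_shift 0 x) subr0; apply: filterS => z /=.
have -> : (F \o +%R^~ x - (cst (F x) + 'd F x)) z = F (z + x) - (F x + 'd F x z) by [].
by rewrite addrK distrC opprB (addrC (F x)) -addrA.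
Qed.

Lemma near_cst_diff (F : V -> R) x c : differentiable F x ->
  (\forall z \near x, F z = c) -> forall h, 'd F x h = 0.
Proof.
move=> dF Fc h; rewrite -deriveE// /derive; apply: cvg_lim => //; apply: cvg_near_cst.
have ht : (t *: h + x) @[t --> (0 : R)^'] --> x.
  rewrite -[X in _ --> X]add0r -(scale0r h); apply: cvgD; last exact: cvg_cst.
by apply: cvgZr_tmp; exact: cvg_within.
have {ht} := ht _ Fc.
apply: (@filterS _ _ _ (fun t => F (t *: h + x) = c)) => t Ft; rewrite /= Ft.
by rewrite (nbhs_singleton Fc) subrr scaler0.
Qed.

End FirstOrder.

Lemma norm_row_le {R : realType} {p : nat} (h : 'rV[R]_p) :
  `|h| <= \sum_a `|h 0 a|.
Proof.
have [->|h0] := eqVneq `|h| 0; first exact: sumr_ge0.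
have [[i a] /= hE] := mx_norm_neq0 h0.
rewrite [`|h|]hE (ord1 i) (bigD1 a)//= lerDl; exact: sumr_ge0.
Qed.

(** * The Lagrange function of the lower level *)

Section KKTSystem.
Context {R : realType} {I J : finType} {n m : nat}.
Variables (g : I -> 'rV[R]_n * 'rV[R]_m -> R) (v : J -> 'rV[R]_m -> R).
Hypotheses (g_C2 : forall i, C2 (g i)) (v_C2 : forall j, C2 (v j)).

(** A function of the pair of points, since both vary along the implicit functions. *)
Definition lagr_partial i (mu : J -> R) (a : 'I_m) (p : 'rV[R]_n * 'rV[R]_m) : R :=
  'd (g i) p (0, delta_mx 0 a) - \sum_j mu j * 'd (v j) (p.2 : 'rV[R]_m) (delta_mx 0 a).

Definition lagr_hessian i x y (mu : J -> R) (a b : 'I_m) : R :=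
  'd (fun w => 'd (g i) w (0, delta_mx 0 a)) (x, y) (0, delta_mx 0 b)
  - \sum_j mu j * 'd (fun z => 'd (v j) z (delta_mx 0 a)) y (delta_mx 0 b).

Lemma g_diff i p : differentiable (g i) p.
Proof. by have [/(_ p Logic.I)[]] := g_C2 i. Qed.
Lemma v_diff j y : differentiable (v j) y.
Proof. by have [/(_ y Logic.I)[]] := v_C2 j. Qed.
Lemma g_partial_diff i h p : differentiable (fun w => 'd (g i) w h) p.
Proof. by have [_ /(_ h p Logic.I)[]] := g_C2 i. Qed.
Lemma v_partial_diff j h y : differentiable (fun z => 'd (v j) z h) y.
Proof. by have [_ /(_ h y Logic.I)[]] := v_C2 j. Qed.

Lemma is_diff_lagrangian i x mu y :
  is_diff y (fun z => lagrangian g v i x z mu)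
    (fun h => 'd (g i) (x, y) (0, h) - \sum_j mu j * 'd (v j) y h).
Proof.
rewrite /lagrangian.
have G := is_diff_pair_comp (@g_diff i (x, y)) (is_diff_cst x y) (is_diff_id y).
have S : is_diff y (fun z => \sum_j mu j * v j z) (fun h => \sum_j mu j * 'd (v j) y h).
  apply: is_diff_fsum => j.
  by apply: (@is_diffZ _ _ _ (v j)); exact: DiffDef (v_diff j y) _.
exact: is_diffB G S.
Qed.

Lemma lagr_gradE i x mu y a :
  grad (fun z => lagrangian g v i x z mu) y 0 a = lagr_partial i mu a (x, y).
Proof. by rewrite mxE; have [_ ->] := is_diff_lagrangian i x mu y. Qed.

Lemma is_diff_lagr_partial i x mu y a :
  is_diff y (fun z => lagr_partial i mu a (x, z))
    (fun h => 'd (fun w => 'd (g i) w (0, delta_mx 0 a)) (x, y) (0, h)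
     - \sum_j mu j * 'd (fun z => 'd (v j) z (delta_mx 0 a)) y h).
Proof.
rewrite /lagr_partial.
have G := is_diff_pair_comp (@g_partial_diff i (0, delta_mx 0 a) (x, y))
  (is_diff_cst x y) (is_diff_id y).
have S : is_diff y (fun z => \sum_j mu j * 'd (v j) z (delta_mx 0 a))
  (fun h => \sum_j mu j * 'd (fun z => 'd (v j) z (delta_mx 0 a)) y h).
  apply: is_diff_fsum => j.
  by apply: (@is_diffZ _ _ _ (fun z => 'd (v j) z (delta_mx 0 a)));
    exact: DiffDef (v_partial_diff j (delta_mx 0 a) y) _.
exact: is_diffB G S.
Qed.

Lemma lagr_hessianE i x mu y a b :
  hessian (fun z => lagrangian g v i x z mu) y a b = lagr_hessian i x y mu a b.
Proof.
rewrite mxE (_ : (fun w => 'd (fun z => lagrangian g v i x z mu) w (delta_mx 0 a))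
   = (fun z => lagr_partial i mu a (x, z))); last first.
  apply/funext => z; have [_ E] := is_diff_lagrangian i x mu z.
  exact: (congr1 (fun L => L (delta_mx 0 a)) E).
by have [_ ->] := is_diff_lagr_partial i x mu y a.
Qed.

Lemma lagr_hessian_sum i x y mu a (h : 'rV[R]_m) :
  \sum_b lagr_hessian i x y mu a b * h 0 b =
  'd (fun w => 'd (g i) w (0, delta_mx 0 a)) (x, y) (0, h)
     - \sum_j mu j * 'd (fun z => 'd (v j) z (delta_mx 0 a)) y h.
Proof.
rewrite diff_pair_sumr.
under [X in _ = _ - X]eq_bigr => j _ do rewrite diff_row_sum mulr_sumr.
rewrite exchange_big -sumrB; apply: eq_bigr => b _.
rewrite /lagr_hessian mulrBl mulr_suml mulrC; congr (_ - _).
by apply: eq_bigr => j _; rewrite mulrAC -mulrA.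
Qed.

End KKTSystem.

(** * The linearized KKT system at a regular point *)

Section KKTMatrix.
Context {R : realType} {J : finType} {m : nat}.

(** The matrix of the linearized KKT system in the unknowns (d, e), variations of the
    point and of the multipliers: H d - D1^T e, then D2 d for active constraints,
    and e itself for inactive ones, whose multipliers are locally zero.  The Jacobian
    appears twice because the two occurrences are sometimes evaluated at different
    points. *)
Definition kkt_matrix (H : 'I_m -> 'I_m -> R) (D1 D2 : J -> 'I_m -> R)
    (P : pred J) (t s : 'I_m + J) : R :=
  match t, s with
  | inl a, inl b => H a b
  | inl a, inr j => - D1 j a
  | inr j, inl b => if P j then D2 j b else 0
  | inr j, inr l => if P j then 0 else (j == l)%:R
  end.

Lemma kkt_matrix_stationarity H D1 D2 P a (u : 'I_m + J -> R) :
  \sum_s kkt_matrix H D1 D2 P (inl a) s * u s =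
  \sum_b H a b * u (inl b) - \sum_j u (inr j) * D1 j a.
Proof.
rewrite big_sumType /= -sumrN; congr (_ + _).
by apply: eq_bigr => j _; rewrite mulNr mulrC.
Qed.

Lemma kkt_matrix_constraint H D1 D2 P j (u : 'I_m + J -> R) :
  \sum_s kkt_matrix H D1 D2 P (inr j) s * u s =
  if P j then \sum_b D2 j b * u (inl b) else u (inr j).
Proof.
rewrite big_sumType /=; case: (P j).
  by rewrite [X in _ + X]big1 ?addr0// => l _; rewrite mul0r.
rewrite big1 ?add0r; last by move=> b _; rewrite mul0r.
rewrite (bigD1 j)//= eqxx mul1r big1 ?addr0// => l lj.
by rewrite eq_sym (negbTE lj) mul0r.
Qed.

Lemma kkt_matrix_cvg {K : Type} {G : set_system K} {FG : Filter G}
    (Hk : K -> 'I_m -> 'I_m -> R) (Dk1 Dk2 : K -> J -> 'I_m -> R) H D1 D2 P :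
  (forall a b, Hk k a b @[k --> G] --> H a b) ->
  (forall j a, Dk1 k j a @[k --> G] --> D1 j a) ->
  (forall j a, Dk2 k j a @[k --> G] --> D2 j a) ->
  forall t s, kkt_matrix (Hk k) (Dk1 k) (Dk2 k) P t s @[k --> G] -->
              kkt_matrix H D1 D2 P t s.
Proof.
move=> cH c1 c2 [a|j] [b|l] /=; first exact: cH.
- by apply: cvgN; exact: c1.
- by case: (P j); [exact: c2|exact: cvg_cst].
- by exact: cvg_cst.
Qed.

End KKTMatrix.

Section Regular.
Context {R : realType} {I J : finType} {n m : nat}.
Variables (g : I -> 'rV[R]_n * 'rV[R]_m -> R) (v : J -> 'rV[R]_m -> R).
Hypotheses (g_C2 : forall i, C2 (g i)) (v_C2 : forall j, C2 (v j)).

Definition constraint_jacobian y j (a : 'I_m) : R := 'd (v j) y (delta_mx 0 a).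
Definition active_constraint y : pred J := fun j => v j y == 0.

Lemma constraint_jacobian_sum y j (h : 'rV[R]_m) :
  \sum_b constraint_jacobian y j b * h 0 b = 'd (v j) y h.
Proof. by rewrite diff_row_sum; apply: eq_bigr => b _; rewrite mulrC. Qed.

Lemma LICQ_injective y (e : J -> R) : LICQ v y ->
  (forall j, ~~ active_constraint y j -> e j = 0) ->
  (forall a, \sum_j e j * constraint_jacobian y j a = 0) -> forall j, e j = 0.
Proof.
move=> /(free_filter_enum (P := active_constraint y)) licq eP eD; apply: licq => //.
apply/rowP => a; rewrite summxE mxE -[RHS](eD a).
by apply: eq_bigr => j _; rewrite !mxE.
Qed.

(** A solution (d, e) of the homogeneous system has d tangent to the active
    constraints and e supported on them, so d^T H d = e^T D d = 0 and the
    second-order condition gives d = 0; then e = 0 by LICQ.  Strict complementarity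
    identifies the active constraints with those having a positive multiplier. *)
Lemma kkt_injective i x y mu (u : 'I_m + J -> R) :
  LICQ v y -> strict_complementarity v y mu ->
  second_order_sufficient g v i x y mu ->
  (forall t, \sum_s kkt_matrix (lagr_hessian g v i x y mu) (constraint_jacobian y)
     (constraint_jacobian y) (active_constraint y) t s * u s = 0) ->
  forall s, u s = 0.
Proof.
move=> licq sc sosc u0.
pose d : 'rV[R]_m := \row_b u (inl b).
have stat a : \sum_b lagr_hessian g v i x y mu a b * d 0 b
     = \sum_j u (inr j) * constraint_jacobian y j a.
  have := u0 (inl a); rewrite kkt_matrix_stationarity => /subr0_eq <-.
  by apply: eq_bigr => b _; rewrite mxE.
have tang j : active_constraint y j -> 'd (v j) y d = 0.
  move=> Pj; have := u0 (inr j); rewrite kkt_matrix_constraint Pj => uj.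
  rewrite -constraint_jacobian_sum -[RHS]uj.
  by apply: eq_bigr => b _; rewrite mxE.
have inact j : ~~ active_constraint y j -> u (inr j) = 0.
  by move=> /negbTE Pj; have := u0 (inr j); rewrite kkt_matrix_constraint Pj.
have d0 : d = 0.
  apply: contrapT => /eqP d0.
  have : (d *m hessian (fun z => lagrangian g v i x z mu) y *m d^T) 0 0 < 0.
    apply: sosc => // j muj; apply: tang; have := sc j.
    by rewrite (gt_eqF muj).
  apply/negP; rewrite -leNgt le_eqVlt; apply/orP; left; apply/eqP/esym.
  transitivity (\sum_a d 0 a * \sum_b lagr_hessian g v i x y mu a b * d 0 b).
    rewrite mxE (eq_bigr (fun b => \sum_a d 0 a
        * hessian (fun z => lagrangian g v i x z mu) y a b * d 0 b)); last first.
      by move=> b _; rewrite mxE mulr_suml; apply: eq_bigr => a _; rewrite [d^T _ _]mxE.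
    rewrite exchange_big; apply: eq_bigr => a _; rewrite mulr_sumr.
    by apply: eq_bigr => b _; rewrite lagr_hessianE// mulrA.
  under eq_bigr => a _ do rewrite stat mulr_sumr.
  rewrite exchange_big big1// => j _.
  have [Pj|Pj] := boolP (active_constraint y j); last first.
    by rewrite big1// => a _; rewrite inact// mul0r mulr0.
  under eq_bigr => a _ do rewrite mulrCA (mulrC (d 0 a)).
  by rewrite -mulr_sumr constraint_jacobian_sum tang// mulr0.
move=> [b|]; first by have := congr1 (fun w : 'rV[R]_m => w 0 b) d0; rewrite !mxE.
apply: (LICQ_injective licq inact) => a.
by rewrite -stat big1// => b _; rewrite d0 mxE mulr0.
Qed.

Lemma grad_lagr0 i x y mu : grad (fun z => lagrangian g v i x z mu) y = 0 ->
  forall a, lagr_partial g v i mu a (x, y) = 0.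
Proof. by move=> g0 a; rewrite -lagr_gradE// g0 mxE. Qed.

End Regular.

(** * Stability of multipliers and of active constraints *)

Section Stability.
Context {R : realType} {I J : finType} {n m : nat}.
Variables (g : I -> 'rV[R]_n * 'rV[R]_m -> R) (v : J -> 'rV[R]_m -> R).
Hypotheses (g_C2 : forall i, C2 (g i)) (v_C2 : forall j, C2 (v j)).

Section Along.
Context {K : Type} {G : set_system K} {FG : Filter G}.
Variables (x : K -> 'rV[R]_n) (y : K -> 'rV[R]_m).
Variables (x0 : 'rV[R]_n) (y0 : 'rV[R]_m).
Hypotheses (xx0 : x @ G --> x0) (yy0 : y @ G --> y0).

Lemma v_cvg j : v j (y k) @[k --> G] --> v j y0.
Proof. by apply: C1_cvg => //; have [] := v_C2 j. Qed.

Lemma constraint_jacobian_cvg j a :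
  constraint_jacobian v (y k) j a @[k --> G] --> constraint_jacobian v y0 j a.
Proof.
apply: diff_cvg => //; first by have [] := v_C2 j.
exact: cvg_cst.
Qed.

Lemma lagr_partial_cvg (mu : K -> J -> R) (mu0 : J -> R) i a :
  (forall j, mu k j @[k --> G] --> mu0 j) ->
  lagr_partial g v i (mu k) a (x k, y k) @[k --> G] --> lagr_partial g v i mu0 a (x0, y0).
Proof.
move=> mumu0; apply: cvgB.
  apply: diff_pair_cvg => //; try exact: cvg_cst.
  by have [] := g_C2 i.
apply: cvg_fsum => j _; apply: cvgM; first exact: mumu0.
exact: constraint_jacobian_cvg.
Qed.

Lemma lagr_hessian_cvg (mu : K -> J -> R) (mu0 : J -> R) i a b :
  (forall j, mu k j @[k --> G] --> mu0 j) ->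
  lagr_hessian g v i (x k) (y k) (mu k) a b @[k --> G] --> lagr_hessian g v i x0 y0 mu0 a b.
Proof.
move=> mumu0; apply: cvgB.
  apply: diff_pair_cvg => //; try exact: cvg_cst.
  by have [_] := g_C2 i; apply.
apply: cvg_fsum => j _; apply: cvgM; first exact: mumu0.
apply: diff_cvg => //; last exact: cvg_cst.
by have [_] := v_C2 j; apply.
Qed.

Lemma inactive_near j : index_set v y0 -> ~~ active_constraint v y0 j ->
  \forall k \near G, v j (y k) < 0.
Proof.
move=> Yy0 Pj; apply: (cvgr_lt _ (@v_cvg j)).
by rewrite lt_neqAle Pj Yy0.
Qed.

(** The differences of the multipliers solve a linear system whose matrix, the
    transposed Jacobian completed by the unit rows of the inactive constraints, is
    injective in the limit by LICQ, and whose right-hand side is the gradient of the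
    Lagrange function with the limit multiplier, which tends to 0. *)
Lemma multiplier_cvg (mu : K -> J -> R) (mu0 : J -> R) i :
  lower_KKT g v i x0 y0 mu0 -> LICQ v y0 ->
  (\forall k \near G, lower_KKT g v i (x k) (y k) (mu k)) ->
  forall j, mu k j @[k --> G] --> mu0 j.
Proof.
move=> [Yy0 grad0 _ comp0] licq kkt j0.
pose A z (t : 'I_m + J) j := match t with
  | inl a => constraint_jacobian v z j a
  | inr l => if active_constraint v y0 l then 0 else (l == j)%:R end.
have injA u : (forall t, \sum_j A y0 t j * u j = 0) -> forall j, u j = 0.
  move=> Au; apply: (LICQ_injective licq) => [j Pj|a].
    have := Au (inr j); rewrite /= (negbTE Pj) (bigD1 j)//= eqxx mul1r big1 ?addr0//.
    by move=> l lj; rewrite eq_sym (negbTE lj) mul0r.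
  by rewrite -[RHS](Au (inl a)); apply: eq_bigr => j _; rewrite mulrC.
have cA t j : A (y k) t j @[k --> G] --> A y0 t j.
  by case: t => [a|l] /=; [exact: constraint_jacobian_cvg|exact: cvg_cst].
have [C C0 bound] := perturbed_injective_bound injA cA.
have inact : \forall k \near G, forall j, ~~ active_constraint v y0 j -> v j (y k) < 0.
  apply: filter_forall => j; have [Pj|Pj] := boolP (active_constraint v y0 j).
    by apply: nearW.
  by apply: filterS (inactive_near Yy0 Pj).
have partial0 : C * (\sum_a `|lagr_partial g v i mu0 a (x k, y k)|) @[k --> G] --> (0 : R).
  apply: (cvg_congr (frefl _) (esym (mulr0 C))); apply: cvgMl_tmp.
  have S0 : \sum_(a < m) `|lagr_partial g v i mu0 a (x0, y0)| = 0.
    by rewrite big1// => a _; rewrite (grad_lagr0 g_C2 v_C2 grad0) normr0.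
  apply: (cvg_congr (frefl _) (esym S0)).
  apply: cvg_fsum => a _; apply: cvg_norm.
  by apply: lagr_partial_cvg => j; exact: cvg_cst.
apply/subr_cvg0; apply: norm_cvg0.
apply: (squeeze_cvgr _ (@cvg_cst _ 0 K G _) partial0).
near=> k; rewrite normr_ge0 /=.
have bk : forall u : J -> R,
    \sum_s `|u s| <= C * \sum_t `|\sum_s A (y k) t s * u s| by near: k.
have {}bk := bk (fun j => mu k j - mu0 j).
apply: (le_trans _ (le_trans bk _)).
  by rewrite (bigD1 j0)//= lerDl; exact: sumr_ge0.
rewrite ler_wpM2l// big_sumType /= [X in _ + X]big1 ?addr0; last first.
  move=> l _; apply/eqP; rewrite normr_eq0; apply/eqP.
  have [Pl|Pl] := boolP (active_constraint v y0 l).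
    by rewrite big1// => j _; rewrite mul0r.
  rewrite (bigD1 l)//= eqxx mul1r big1 ?addr0; last first.
    by move=> j jl; rewrite eq_sym (negbTE jl) mul0r.
  have [_ _ _ compk] : lower_KKT g v i (x k) (y k) (mu k) by near: k.
  have vk : forall j, ~~ active_constraint v y0 j -> v j (y k) < 0 by near: k.
  have /eqP := compk l; rewrite mulf_eq0 (lt_eqF (vk l Pl)) orbF => /eqP ->.
  have /eqP := comp0 l; rewrite mulf_eq0 orbC.
  by rewrite (negbTE Pl : v l y0 == 0 = false) => /eqP ->; rewrite subrr.
apply: ler_sum => a _.
have [_ gradk _ _] : lower_KKT g v i (x k) (y k) (mu k) by near: k.
have := grad_lagr0 g_C2 v_C2 gradk a; rewrite /lagr_partial => /subr0_eq ->.
rewrite -sumrB /= le_eqVlt; apply/orP; left; apply/eqP; congr (`|_|).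
by apply: eq_bigr => j _; rewrite -mulrBl mulrC.
Unshelve. all: by end_near. Qed.

(** An inactive constraint stays inactive, hence has multiplier 0.  An active one has a
    positive limit multiplier by strict complementarity, so its multiplier is
    eventually positive and the constraint is active. *)
Lemma active_set_stable (mu : K -> J -> R) (mu0 : J -> R) i :
  lower_KKT g v i x0 y0 mu0 -> LICQ v y0 -> strict_complementarity v y0 mu0 ->
  (\forall k \near G, lower_KKT g v i (x k) (y k) (mu k)) ->
  \forall k \near G, forall j,
    if active_constraint v y0 j then 0 < mu k j /\ v j (y k) = 0
    else v j (y k) < 0 /\ mu k j = 0.
Proof.
move=> kkt0 licq sc kkt; have mumu0 := multiplier_cvg kkt0 licq kkt.
have [Yy0 _ mu0_ge0 _] := kkt0; apply: filter_forall => j.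
have [Pj|Pj] := boolP (active_constraint v y0 j).
  have muj : 0 < mu0 j.
    by rewrite lt_neqAle mu0_ge0 eq_sym andbT; have := sc j; rewrite (Pj : v j y0 == 0) addbT.
  near=> k; have [_ _ _ /(_ j)/eqP] : lower_KKT g v i (x k) (y k) (mu k) by near: k.
  have muk : 0 < mu k j by near: k; exact: (cvgr_gt _ (mumu0 j)).
  by rewrite mulf_eq0 gt_eqF//= => /eqP.
near=> k; have [_ _ _ /(_ j)/eqP] : lower_KKT g v i (x k) (y k) (mu k) by near: k.
have vk : v j (y k) < 0 by near: k; exact: inactive_near.
by rewrite mulf_eq0 (lt_eqF vk) orbF => /eqP.
Unshelve. all: by end_near. Qed.

End Along.
End Stability.

(** * Finiteness of the set of active indices *)

Section Isolation.
Context {R : realType} {I J : finType} {n m : nat}.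
Variables (g : I -> 'rV[R]_n * 'rV[R]_m -> R) (v : J -> 'rV[R]_m -> R).
Hypotheses (g_C2 : forall i, C2 (g i)) (v_C2 : forall j, C2 (v j)).

(** A nearby active index z is also a KKT point, with a nearby multiplier and the same
    active constraints.  So the difference of the two KKT pairs satisfies the
    linearized system up to o(|z - y0|), and the uniform bound forces it to vanish. *)
Lemma active_index_isolated x0 i y0 : reduction_ansatz g v x0 ->
  active_indices g v i x0 y0 ->
  \forall z \near y0, active_indices g v i x0 z -> z = y0.
Proof.
move=> ansatz act0.
have [mu muP] : {mu : 'rV[R]_m -> J -> R & forall z,
    active_indices g v i x0 z -> lower_KKT g v i x0 z (mu z)}.
  apply: (@choice _ _ (fun z mu => active_indices g v i x0 z -> lower_KKT g v i x0 z mu)) => z.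
  have [/ansatz[_ _ [mu [kkt _ _]]]|] := pselect (active_indices g v i x0 z).
    by exists mu.
  by exists (fun=> 0).
have [Yy0 licq [mu0 [kkt0 sc sosc]]] := ansatz i y0 act0.
pose A := active_indices g v i x0.
(* active indices tending to y0 *)
pose G := within A (nbhs y0).
have idG : (fun z : 'rV[R]_m => z) @ G --> y0 by exact: cvg_within.
have cstG : (fun z : 'rV[R]_m => x0) @ G --> x0 by exact: cvg_cst.
have kktG : \forall z \near G, lower_KKT g v i x0 z (mu z).
  by near=> z; apply: muP; near: z; exact: withinT.
have mumu0 := multiplier_cvg g_C2 v_C2 cstG idG kkt0 licq kktG.
have stable := active_set_stable g_C2 v_C2 cstG idG kkt0 licq sc kktG.
pose a z := kkt_matrix (lagr_hessian g v i x0 y0 mu0) (constraint_jacobian v z)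
  (constraint_jacobian v y0) (active_constraint v y0).
have acvg t s : a z t s @[z --> G] --> a y0 t s.
  apply: kkt_matrix_cvg => [b c|j b|j b]; [exact: cvg_cst| |exact: cvg_cst].
  exact: (constraint_jacobian_cvg v_C2 idG).
have [C C0 bound] := perturbed_injective_bound (fun u =>
  @kkt_injective _ _ _ _ _ _ _ g_C2 v_C2 i x0 y0 mu0 u licq sc sosc) acvg.
pose N := C * #|{: 'I_m + J}|%:R.
have N0 : 0 <= N by rewrite mulr_ge0.
(* chosen so that the o(|z - y0|) errors, amplified by the bound, amount to at
   most half of the left-hand side *)
pose e := 1 / 2 / (N + 1).
have e0 : 0 < e by rewrite !divr_gt0// ltr_wpDl.
have Ne : N * e <= 1 / 2.
  rewrite /e mulrCA ler_piMr// ler_pdivrMr ?mul1r ?lerDl//.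
  by rewrite ltr_wpDl.
have withinG P : (\forall z \near y0, P z) -> \forall z \near G, P z.
  by move=> y0P; exact: (@cvg_within _ (nbhs y0) _ A P y0P).
have estL : \forall z \near G, forall b,
    `|'d (fun z => lagr_partial g v i mu0 b (x0, z)) y0 (z - y0)
      - (lagr_partial g v i mu0 b (x0, z) - lagr_partial g v i mu0 b (x0, y0))|
    <= e * `|z - y0|.
  apply: filter_forall => b; apply: withinG.
  apply: (@differentiable_estimate _ _ (fun z => lagr_partial g v i mu0 b (x0, z))) => //.
  by have [] := is_diff_lagr_partial g_C2 v_C2 i x0 mu0 y0 b.
have estV : \forall z \near G, forall j,
    `|'d (v j) y0 (z - y0) - (v j z - v j y0)| <= e * `|z - y0|.
  apply: filter_forall => j; apply: withinG.
  by apply: differentiable_estimate => //; exact: v_diff.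
have : \forall z \near G, z = y0.
  near=> z.
  pose u (s : 'I_m + J) :=
    match s with inl b => (z - y0) 0 b | inr j => mu z j - mu0 j end.
  have : forall w : 'I_m + J -> R,
      \sum_s `|w s| <= C * \sum_t `|\sum_s a z t s * w s| by near: z.
  move=> /(_ u); set S := \sum_s `|u s| => uS.
  have zS : `|z - y0| <= S.
    rewrite (le_trans (norm_row_le _))// /S big_sumType /= lerDl.
    exact: sumr_ge0.
  have kktz : lower_KKT g v i x0 z (mu z) by near: z.
  have stz : forall j, if active_constraint v y0 j then 0 < mu z j /\ v j z = 0
    else v j z < 0 /\ mu z j = 0 by near: z; exact: stable.
  have estLz : forall b,
    `|'d (fun z => lagr_partial g v i mu0 b (x0, z)) y0 (z - y0)
      - (lagr_partial g v i mu0 b (x0, z) - lagr_partial g v i mu0 b (x0, y0))|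
    <= e * `|z - y0| by near: z; exact: estL.
  have estVz : forall j, `|'d (v j) y0 (z - y0) - (v j z - v j y0)| <= e * `|z - y0|.
    by near: z; exact: estV.
  have row t : `|\sum_s a z t s * u s| <= e * S.
    apply: (@le_trans _ _ (e * `|z - y0|)); last by rewrite ler_wpM2l// ltW.
    case: t => [b|j].
      rewrite /a kkt_matrix_stationarity /=.
      have -> : \sum_b0 lagr_hessian g v i x0 y0 mu0 b b0 * (z - y0) 0 b0
          = 'd (fun z => lagr_partial g v i mu0 b (x0, z)) y0 (z - y0).
        have [_ E] := is_diff_lagr_partial g_C2 v_C2 i x0 mu0 y0 b.
        by rewrite lagr_hessian_sum; exact: (esym (congr1 (fun L => L (z - y0)) E)).
      have -> : \sum_j (mu z j - mu0 j) * constraint_jacobian v z j b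
          = lagr_partial g v i mu0 b (x0, z) - lagr_partial g v i mu0 b (x0, y0).
        have [_ gr0 _ _] := kkt0; rewrite (grad_lagr0 g_C2 v_C2 gr0) subr0.
        have [_ grz _ _] := kktz.
        have := grad_lagr0 g_C2 v_C2 grz b; rewrite /lagr_partial => /subr0_eq ->.
        by rewrite -sumrB; apply: eq_bigr => j _; rewrite mulrBl.
      exact: estLz.
    rewrite /a kkt_matrix_constraint /=; have := stz j.
    case: ifPn => Pj [H1 H2].
      rewrite constraint_jacobian_sum.
      have := estVz j; rewrite H2 (eqP (Pj : v j y0 == 0)) !subr0; exact.
    have -> : mu0 j = 0.
      have [_ _ _ /(_ j)/eqP] := kkt0; rewrite mulf_eq0 orbC.
      by rewrite (negbTE Pj : v j y0 == 0 = false) => /eqP.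
    by rewrite H2 subrr normr0 mulr_ge0// ltW.
  have S0 : 0 <= S by exact: sumr_ge0.
  have : S <= 1 / 2 * S.
    apply: (le_trans uS); apply: (@le_trans _ _ (N * e * S)); last by rewrite ler_wpM2r.
    rewrite -(mulrA N) /N -(mulrA C) ler_wpM2l//.
    apply: (@le_trans _ _ (\sum_(t : 'I_m + J) e * S)).
      by apply: ler_sum => t _; exact: row.
    by rewrite sumr_const -[X in X <= _]mulr_natl.
  move=> S12; apply/subr0_eq/eqP; rewrite -normr_le0 (le_trans zS)//; lra.
by [].
Unshelve. all: by end_near. Qed.

(** Each point of the compact index set has a neighbourhood containing at most one
    active index. *)
Lemma active_indices_finite x0 i : compact (index_set v) -> reduction_ansatz g v x0 ->
  finite_set (active_indices g v i x0).
Proof.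
rewrite compact_cover => Yc ansatz.
pose A := active_indices g v i x0.
have [z Yz|z Yz|D _ YD] := Yc 'rV[R]_m (index_set v)
    (fun z => interior [set z' | A z' -> z' = z]).
- exact: open_interior.
- exists z => //=; rewrite /interior /=.
  have [Az|nAz] := pselect (A z); first exact: active_index_isolated.
  have gz : g i (x0, z) != 0 by apply/eqP => gz; apply: nAz; split.
  have gc : g i (x0, z') @[z' --> z] --> g i (x0, z).
    have [C1g _] := g_C2 i.
    have idz : (fun z' : 'rV[R]_m => z') @ z --> z by exact: cvg_id.
    exact: (C1_pair_cvg C1g (@cvg_cst _ x0 _ (nbhs z) _) idz).
  have : \forall z' \near z, g i (x0, z') != 0 by exact: (cvgr_neq0 _ gc gz).
  by apply: filterS => z' + [_ gz'0]; rewrite gz'0 eqxx.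
apply: (sub_finite_set _ (finite_fset D)) => z Az.
have [Yz _] := Az; have [w Dw /interior_subset] := YD z Yz.
by move=> /(_ Az) ->.
Qed.

End Isolation.

(** * Derivatives of the implicit functions *)

Section Implicit.
Context {R : realType} {I J : finType} {n m : nat}.
Variables (g : I -> 'rV[R]_n * 'rV[R]_m -> R) (v : J -> 'rV[R]_m -> R).
Hypotheses (g_C2 : forall i, C2 (g i)) (v_C2 : forall j, C2 (v j)).

(** The arithmetic that ends [implicit_stationarity], kept apart from the differentials
    it is applied to. *)
Lemma split_sub_opp (X A B S1 S2 Sum T : R) :
  X - Sum = 0 -> X = A + B -> Sum = S1 + S2 -> T = B - S1 -> T - S2 = - A.
Proof. by move=> E XE SE ->; move: E; rewrite XE SE => E; lra. Qed.

Section AtPoint.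
Variables (i : I) (x0 : 'rV[R]_n) (y0 : 'rV[R]_m) (mu0 : J -> R).
Variables (yf : 'rV[R]_n -> 'rV[R]_m) (muf : 'rV[R]_n -> J -> R).
Hypothesis impl : implicit_KKT g v i x0 y0 mu0 yf muf.

Lemma implicit_near : [/\ differentiable yf x0,
  forall j, differentiable (fun x => muf x j) x0 &
  \forall x \near x0, lower_KKT g v i x (yf x) (muf x)].
Proof.
have [_ _ [U [V [oU _ yC muC UP]]]] := impl.
have Ux0 : U x0 by have [] := oU.
split=> [|j|]; [by have [] := yC x0 Ux0|by have [] := muC j x0 Ux0|].
by apply: filterS (open_nbhs_nbhs oU) => x /UP[].
Qed.

(** The derivative of the identity D_2 L(x, yf x, muf x) = 0 in the direction [h]. *)
Lemma implicit_stationarity h a :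
  \sum_b lagr_hessian g v i x0 y0 mu0 a b * ('d yf x0 h) 0 b
  - \sum_j 'd (fun x => muf x j) x0 h * constraint_jacobian v y0 j a
  = - 'd (fun w => 'd (g i) w (0, delta_mx 0 a)) (x0, y0) (h, 0).
Proof.
have [dy dmu kkt] := implicit_near.
have [yE muE _] := impl.
have iy : is_diff x0 yf ('d yf x0) by exact: DiffDef.
pose p := fun x => lagr_partial g v i (muf x) a (x, yf x).
have ip : is_diff x0 p (fun h =>
    'd (fun w => 'd (g i) w (0, delta_mx 0 a)) (x0, yf x0) (h, 'd yf x0 h)
    - \sum_j (muf x0 j * 'd (fun z => 'd (v j) z (delta_mx 0 a)) (yf x0) ('d yf x0 h)
       + 'd (v j) (yf x0) (delta_mx 0 a) * 'd (fun x => muf x j) x0 h)).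
  have i1 := is_diff_pair_comp (a := id)
    (@g_partial_diff _ _ _ _ _ g_C2 i (0, delta_mx 0 a) (x0, yf x0)) (is_diff_id x0) iy.
  have i2 : is_diff x0 (fun x => \sum_j muf x j * 'd (v j) (yf x) (delta_mx 0 a))
     (fun h => \sum_j (muf x0 j * 'd (fun z => 'd (v j) z (delta_mx 0 a)) (yf x0) ('d yf x0 h)
       + 'd (v j) (yf x0) (delta_mx 0 a) * 'd (fun x => muf x j) x0 h)).
    apply: is_diff_fsum => j.
    have i3 := is_diff_row_comp (@v_partial_diff _ _ _ _ v_C2 j (delta_mx 0 a) (yf x0)) iy.
    have i4 : is_diff x0 (fun x => muf x j) ('d (fun x => muf x j) x0) by exact: DiffDef.
    exact: is_diffM i4 i3.
  exact: is_diffB i1 i2.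
have [dp pE] := ip.
have p0 : \forall x \near x0, p x = 0.
  by apply: filterS kkt => x [_ grx _ _]; exact: (grad_lagr0 g_C2 v_C2 grx a).
have E := etrans (esym (congr1 (fun L => L h) pE)) (near_cst_diff dp p0 h).
rewrite /= yE in E.
have D := diff_pair_sum (fun w => 'd (g i) w (0, delta_mx 0 a)) (x0, y0) h ('d yf x0 h).
have L := lagr_hessian_sum g v i x0 y0 mu0 a ('d yf x0 h).
have S : \sum_j (muf x0 j * 'd (fun z => 'd (v j) z (delta_mx 0 a)) y0 ('d yf x0 h)
       + 'd (v j) y0 (delta_mx 0 a) * 'd (fun x => muf x j) x0 h)
  = \sum_j mu0 j * 'd (fun z => 'd (v j) z (delta_mx 0 a)) y0 ('d yf x0 h)
    + \sum_j 'd (fun x => muf x j) x0 h * constraint_jacobian v y0 j a.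
  by rewrite -big_split; apply: eq_bigr => j _; congr (_ + _); [rewrite muE|exact: mulrC].
exact: (split_sub_opp E D S L).
Qed.

(** The multiplier stays positive near [x0], so [v j] vanishes along [yf]. *)
Lemma implicit_tangent h j : 0 < mu0 j -> 'd (v j) y0 ('d yf x0 h) = 0.
Proof.
move=> muj; have [dy dmu kkt] := implicit_near; have [yE muE _] := impl.
have iy : is_diff x0 yf ('d yf x0) by exact: DiffDef.
have [dv vE] := is_diff_row_comp (@v_diff _ _ _ _ v_C2 j (yf x0)) iy.
have v0 : \forall x \near x0, v j (yf x) = 0.
  have mun : \forall x \near x0, 0 < muf x j.
    apply: (cvgr_gt _ (differentiable_continuous (dmu j))).
    by rewrite muE.
  near=> x; have [_ _ _ /(_ j)/eqP] : lower_KKT g v i x (yf x) (muf x) by near: x.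
  have mux : 0 < muf x j by near: x.
  by rewrite mulf_eq0 gt_eqF//= => /eqP.
by have := near_cst_diff dv v0 h; rewrite vE yE.
Unshelve. all: by end_near. Qed.

(** The constraint stays inactive near [x0], so its multiplier is locally 0. *)
Lemma implicit_inactive h j : v j y0 < 0 -> 'd (fun x => muf x j) x0 h = 0.
Proof.
move=> vj; have [dy dmu kkt] := implicit_near; have [yE muE _] := impl.
have mu0n : \forall x \near x0, muf x j = 0.
  have vn : \forall x \near x0, v j (yf x) < 0.
    have c : v j (yf x) @[x --> x0] --> v j (yf x0).
      have [C1v _] := v_C2 j.
      exact: (C1_cvg C1v (differentiable_continuous dy)).
    by apply: (cvgr_lt _ c); rewrite yE.
  near=> x; have [_ _ _ /(_ j)/eqP] : lower_KKT g v i x (yf x) (muf x) by near: x.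
  have vx : v j (yf x) < 0 by near: x.
  by rewrite mulf_eq0 orbC (lt_eqF vx)//= => /eqP.
exact: near_cst_diff (dmu j) mu0n h.
Unshelve. all: by end_near. Qed.

End AtPoint.
End Implicit.

(** * The approximate constraints *)

Lemma is_diff_affine {R : realType} {V W : normedModType R} (L : {linear V -> W}) c x0 z :
  continuous L -> is_diff z (fun z => c + L (z - x0)) L.
Proof.
move=> cL.
have iL : is_diff z L L.
  by apply: DiffDef; [exact: linear_differentiable|exact: diff_lin].
have iA := is_diffD (is_diff_cst (c - L x0) z) iL.
have E : cst (c - L x0) + L = (fun z => c + L (z - x0)).
  by apply/funext => w; rewrite linearB /= -addrA (addrC (- _)).
by rewrite -E; apply: is_diff_eq; rewrite add0r.
Qed.

Section ApproximateConstraint.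
Context {R : realType} {I J : finType} {n m : nat}.
Variables (g : I -> 'rV[R]_n * 'rV[R]_m -> R) (v : J -> 'rV[R]_m -> R).
Hypotheses (g_C2 : forall i, C2 (g i)) (v_C2 : forall j, C2 (v j)).
Variables (x : nat -> 'rV[R]_n) (y : I -> nat -> 'rV[R]_m) (mu : I -> nat -> J -> R).
Variables (yf : I -> nat -> 'rV[R]_n -> 'rV[R]_m).
Variables (muf : I -> nat -> 'rV[R]_n -> J -> R).
Variable i : I.
Hypothesis kkt : forall k, lower_KKT g v i (x k) (y i k) (mu i k).
Hypothesis impl : forall k, implicit_KKT g v i (x k) (y i k) (mu i k) (yf i k) (muf i k).

(** The arithmetic that ends [diff_gbar], kept apart from the differentials it is applied
    to. *)
Lemma split_sub_regroup (X A B Q M S0 T0 P : R) :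
  X = A + B -> B = Q -> S0 = Q - M -> T0 = M + P -> X - T0 = A + S0 - P.
Proof. by move=> -> -> -> ->; ring. Qed.

(** The chain rule, arranged so that the implicit derivatives come with factors that
    tend to 0 at a KKT point: the partial derivatives of the Lagrange function, and the
    constraint values. *)
Lemma diff_gbar k z h :
  'd (gbar g v x y mu yf muf i k) z h =
  'd (g i) (z, ybar x y yf i k z) (h, 0)
  + \sum_b ('d (yf i k) (x k) h) 0 b
      * lagr_partial g v i (mubar x mu muf i k z) b (z, ybar x y yf i k z)
  - \sum_j 'd (fun w => muf i k w j) (x k) h * v j (ybar x y yf i k z).
Proof.
have [dy dmu _] := implicit_near (impl k).
have iy : is_diff z (ybar x y yf i k) ('d (yf i k) (x k)).
  exact: is_diff_affine (diff_continuous dy).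
have imu j : is_diff z (fun z => mubar x mu muf i k z j) ('d (fun w => muf i k w j) (x k)).
  exact: is_diff_affine (diff_continuous (dmu j)).
have i1 := is_diff_pair_comp (a := id) (@g_diff _ _ _ _ _ g_C2 i (z, ybar x y yf i k z))
  (is_diff_id z) iy.
set yb := ybar x y yf i k z; set mb := mubar x mu muf i k z.
have i2 : is_diff z (fun z => \sum_j mubar x mu muf i k z j * v j (ybar x y yf i k z))
   (fun h => \sum_j (mb j * 'd (v j) yb ('d (yf i k) (x k) h)
       + v j yb * 'd (fun w => muf i k w j) (x k) h)).
  apply: is_diff_fsum => j.
  have i3 := is_diff_row_comp (@v_diff _ _ _ _ v_C2 j yb) iy.
  exact: is_diffM (imu j) i3.
have [_ E] := is_diffB i1 i2.
rewrite [LHS](congr1 (fun L => L h) E) /=.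
have D := diff_pair_sum (g i) (z, yb) h ('d (yf i k) (x k) h).
have D2 := diff_pair_sumr (g i) (z, yb) ('d (yf i k) (x k) h).
set d := 'd (yf i k) (x k) h in D D2 *.
have S : \sum_b d 0 b * lagr_partial g v i mb b (z, yb) =
   \sum_b d 0 b * 'd (g i) (z, yb) (0, delta_mx 0 b) - \sum_j mb j * 'd (v j) yb d.
  have -> : \sum_j mb j * 'd (v j) yb d =
      \sum_b d 0 b * (\sum_j mb j * 'd (v j) yb (delta_mx 0 b)).
    rewrite (eq_bigr (fun j => \sum_b d 0 b * (mb j * 'd (v j) yb (delta_mx 0 b)))).
      by rewrite exchange_big; apply: eq_bigr => b _; rewrite mulr_sumr.
    move=> j _; rewrite (diff_row_sum (v j) yb d) mulr_sumr.
    by apply: eq_bigr => b _; rewrite mulrCA.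
  by rewrite -sumrB; apply: eq_bigr => b _; rewrite -mulrBr.
have T : \sum_j (mb j * 'd (v j) yb d + v j yb * 'd (fun w => muf i k w j) (x k) h)
   = \sum_j mb j * 'd (v j) yb d
     + \sum_j 'd (fun w => muf i k w j) (x k) h * v j yb.
  by rewrite -big_split; apply: eq_bigr => j _; congr (_ + _); exact: mulrC.
exact: (split_sub_regroup D D2 S T).
Qed.

Section Limit.
Context {G : set_system nat} {FG : Filter G}.
Variables (xs : 'rV[R]_n) (ys : 'rV[R]_m).
Hypotheses (xx : x @ G --> xs) (xnext : x k.+1 @[k --> G] --> xs) (yy : y i @ G --> ys).
Hypothesis reg : regular_point g v i xs ys.

(** The implicit derivatives solve the linearized KKT system at [y i k], which
    converges to an injective one.  The bound is linear in the direction: it is used for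
    a fixed direction, and for the step from [x k] to [x k.+1], which tends to 0. *)
Lemma implicit_derivative_bound :
  exists2 C : R, 0 <= C & \forall k \near G, forall h,
    \sum_b `|('d (yf i k) (x k) h) 0 b| + \sum_j `|'d (fun w => muf i k w j) (x k) h| <=
    C * \sum_a `|'d (fun w => 'd (g i) w (0, delta_mx 0 a)) (x k, y i k) (h, 0)|.
Proof.
have [Yys licq [mus [kkts sc sosc]]] := reg.
have kktG : \forall k \near G, lower_KKT g v i (x k) (y i k) (mu i k) by exact: nearW.
have mumus : forall j, mu i k j @[k --> G] --> mus j.
  by move=> j; exact: (multiplier_cvg g_C2 v_C2 xx yy kkts licq kktG).
have stable := active_set_stable g_C2 v_C2 xx yy kkts licq sc kktG.
pose A k := kkt_matrix (lagr_hessian g v i (x k) (y i k) (mu i k))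
  (constraint_jacobian v (y i k)) (constraint_jacobian v (y i k)) (active_constraint v ys).
have Acvg t s : A k t s @[k --> G] --> kkt_matrix (lagr_hessian g v i xs ys mus)
    (constraint_jacobian v ys) (constraint_jacobian v ys) (active_constraint v ys) t s.
  apply: kkt_matrix_cvg => [a b|j a|j a].
  - exact: (lagr_hessian_cvg g_C2 v_C2 xx yy mumus).
  - exact: (constraint_jacobian_cvg v_C2 yy).
  - exact: (constraint_jacobian_cvg v_C2 yy).
have [C C0 bound] := perturbed_injective_bound (fun u =>
  @kkt_injective _ _ _ _ _ _ _ g_C2 v_C2 i xs ys mus u licq sc sosc) Acvg.
exists C => //; near=> k => h.
pose u (s : 'I_m + J) := match s with
  | inl b => ('d (yf i k) (x k) h) 0 b | inr j => 'd (fun w => muf i k w j) (x k) h end.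
have : forall w : 'I_m + J -> R,
  \sum_s `|w s| <= C * \sum_t `|\sum_s A k t s * w s| by near: k; exact: bound.
move=> /(_ u); rewrite big_sumType /= => /le_trans; apply.
have stk : forall j, if active_constraint v ys j then 0 < mu i k j /\ v j (y i k) = 0
    else v j (y i k) < 0 /\ mu i k j = 0 by near: k; exact: stable.
rewrite ler_wpM2l// big_sumType -[leRHS]addr0; apply: lerD; last first.
  rewrite big1// => j _; apply/eqP; rewrite normr_eq0; apply/eqP.
  rewrite /A kkt_matrix_constraint /=; have := stk j; case: ifPn => Pj [H1 H2].
    rewrite constraint_jacobian_sum; exact: (implicit_tangent v_C2 (impl k)).
  exact: (implicit_inactive v_C2 (impl k)).
apply: ler_sum => a _; rewrite /A kkt_matrix_stationarity /=.
by rewrite (implicit_stationarity g_C2 v_C2 (impl k)) normrN.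
Unshelve. all: by end_near. Qed.

(** In [diff_gbar] the first term has the announced limit.  In the other terms bounded
    implicit derivatives meet factors tending to 0, except for the derivatives of the
    multipliers of inactive constraints, which are eventually 0 themselves. *)
Lemma gbar_diff_cvg h :
  'd (gbar g v x y mu yf muf i k) (x k.+1) h @[k --> G] --> 'd (g i) (xs, ys) (h, 0).
Proof.
have [Yys licq [mus [kkts sc sosc]]] := reg.
have kktG : \forall k \near G, lower_KKT g v i (x k) (y i k) (mu i k) by exact: nearW.
have mumus : forall j, mu i k j @[k --> G] --> mus j.
  by move=> j; exact: (multiplier_cvg g_C2 v_C2 xx yy kkts licq kktG).
have stable := active_set_stable g_C2 v_C2 xx yy kkts licq sc kktG.
have [C C0 bound] := implicit_derivative_bound.
have [C1g C2g] := g_C2 i.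
pose rhs k (d : 'rV[R]_n) := C * \sum_a
  `|'d (fun w => 'd (g i) w (0, delta_mx 0 a)) (x k, y i k) (d, 0)|.
have rhs_cvg (d : nat -> 'rV[R]_n) d0 : d @ G --> d0 -> rhs k (d k) @[k --> G] -->
    C * \sum_a `|'d (fun w => 'd (g i) w (0, delta_mx 0 a)) (xs, ys) (d0, 0)|.
  move=> dd; apply: cvgMl_tmp; apply: cvg_fsum => a _; apply: cvg_norm.
  have c0 : (fun=> 0 : 'rV[R]_m) @ G --> (0 : 'rV[R]_m) by exact: cvg_cst.
  exact: (diff_pair_cvg (C2g (0, delta_mx 0 a)) xx yy dd c0).
pose step k := x k.+1 - x k.
have step0 : step @ G --> (0 : 'rV[R]_n).
  by rewrite -(subrr xs); exact: cvgB.
have rhs0 : rhs k (step k) @[k --> G] --> (0 : R).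
  have E : C * \sum_a `|'d (fun w => 'd (g i) w (0, delta_mx 0 a)) (xs, ys)
      ((0 : 'rV[R]_n), (0 : 'rV[R]_m))| = 0.
    by rewrite big1 ?mulr0// => a _; rewrite linear0 normr0.
  exact: (cvg_congr (frefl _) (esym E) (rhs_cvg _ _ step0)).
have yb : ybar x y yf i k (x k.+1) @[k --> G] --> ys.
  rewrite -[X in _ --> X]addr0; apply: cvgD => //; apply: norm_cvg0.
  apply: (squeeze_cvgr _ (@cvg_cst _ 0 _ G _) rhs0); near=> k.
  rewrite normr_ge0 /=; apply: (le_trans (norm_row_le _)).
  have bk : forall h, \sum_b `|('d (yf i k) (x k) h) 0 b|
     + \sum_j `|'d (fun w => muf i k w j) (x k) h| <= rhs k h by near: k; exact: bound.
  by apply: le_trans (bk _); rewrite lerDl; exact: sumr_ge0.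
have mb j : mubar x mu muf i k (x k.+1) j @[k --> G] --> mus j.
  rewrite -[X in _ --> X]addr0; apply: cvgD => //; apply: norm_cvg0.
  apply: (squeeze_cvgr _ (@cvg_cst _ 0 _ G _) rhs0); near=> k.
  rewrite normr_ge0 /=.
  have bk : forall h, \sum_b `|('d (yf i k) (x k) h) 0 b|
     + \sum_j `|'d (fun w => muf i k w j) (x k) h| <= rhs k h by near: k; exact: bound.
  apply: le_trans (bk _); apply: ler_wpDl; first exact: sumr_ge0.
  by rewrite (bigD1 j)//= lerDl; exact: sumr_ge0.
have [B Bbound] : exists B, \forall k \near G,
   \sum_b `|('d (yf i k) (x k) h) 0 b| + \sum_j `|'d (fun w => muf i k w j) (x k) h| <= B.
  have ch : (fun _ : nat => h) @ G --> h by exact: cvg_cst.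
  have := rhs_cvg (fun=> h) h ch; set l := C * _ => rh.
  exists (l + 1); near=> k; apply: (@le_trans _ _ (rhs k h)).
    by move: (h); near: k; exact: bound.
  by near: k; apply: (cvgr_le _ rh); rewrite ltrDl.
apply: (cvg_congr (fun k => diff_gbar k (x k.+1) h) (esym (subr0 _))).
apply: cvgB.
  rewrite -[X in _ --> X]addr0; apply: cvgD.
    have ch : (fun _ : nat => h) @ G --> h by exact: cvg_cst.
    have c0 : (fun=> 0 : 'rV[R]_m) @ G --> (0 : 'rV[R]_m) by exact: cvg_cst.
    exact: (diff_pair_cvg C1g xnext yb ch c0).
  have S0 : \sum_(b < m) (0 : R) = 0 by rewrite big1.
  apply: (cvg_congr (frefl _) (esym S0)); apply: cvg_fsum => b _.
  apply: (bounded_mul_cvg0 (C := B)).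
    apply: filterS Bbound => k; apply: le_trans.
    by rewrite (bigD1 b)//= -addrA lerDl addr_ge0//; exact: sumr_ge0.
  have [_ grs _ _] := kkts; rewrite -(grad_lagr0 g_C2 v_C2 grs b).
  exact: (lagr_partial_cvg g_C2 v_C2 xnext yb mb).
have S0 : \sum_(j : J) (0 : R) = 0 by rewrite big1.
apply: (cvg_congr (frefl _) (esym S0)); apply: cvg_fsum => j _.
have [Pj|Pj] := boolP (active_constraint v ys j).
  apply: (bounded_mul_cvg0 (C := B)).
    apply: filterS Bbound => k; apply: le_trans.
    rewrite (bigD1 j)//= addrCA lerDl addr_ge0//; exact: sumr_ge0.
  rewrite -(eqP (Pj : v j ys == 0)); exact: (v_cvg v_C2 yb).
apply: cvg_near_cst; near=> k.
have stk : forall j, if active_constraint v ys j then 0 < mu i k j /\ v j (y i k) = 0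
    else v j (y i k) < 0 /\ mu i k j = 0 by near: k; exact: stable.
have := stk j; rewrite (negbTE Pj) => -[vj _].
by rewrite (implicit_inactive v_C2 (impl k) _ vj) mul0r.
Unshelve. all: by end_near. Qed.

End Limit.
End ApproximateConstraint.

(** Images of ultrafilters are ultrafilters, and those on a compact set converge. *)
(** * Limits of iterates and descent directions *)

Lemma compact_ultra_cvg {K : Type} {T : topologicalType} (U : set_system K)
    (A : set T) (u : K -> T) :
  UltraFilter U -> compact A -> (forall k, A (u k)) -> exists2 p, A p & u @ U --> p.
Proof.
move=> UU Ac Au.
have uU : UltraFilter (u @ U).
  split=> [|H PH sUH]; first exact: fmap_proper_filter.
  apply/seteqP; split=> [B HB|]; last exact: sUH.
  have [//|UB] := in_ultra_setVsetC (u @^-1` B) UU.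
  have HcB : H (~` B) by apply: sUH.
  have [t [Bt]] := @filter_ex _ H _ _ (filterI HB HcB).
  by [].
have uA : (u @ U) A by apply: (@filterS _ U _ setT) => [k _|]; [exact: Au|exact: filterT].
rewrite compact_ultra in Ac.
by have [p [Ap up]] := Ac _ uU uA; exists p.
Qed.

Lemma dot_suml {R : realFieldType} {n : nat} {T : Type} (r : seq T) (P : pred T)
    (F : T -> 'rV[R]_n) w :
  dot (\sum_(t <- r | P t) F t) w = \sum_(t <- r | P t) dot (F t) w.
Proof. by rewrite dotC raddf_sum; apply: eq_bigr => t _; rewrite dotC. Qed.

Lemma small_perturbation {R : realFieldType} (a b : R) : a < 0 ->
  exists2 e, 0 < e & a + e * b < 0.
Proof.
move=> a0; have b1 : 0 < `|b| + 1 by rewrite ltr_wpDl.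
exists (- a / 2 / (`|b| + 1)); first by rewrite !divr_gt0// oppr_gt0.
apply: (@le_lt_trans _ _ (a + - a / 2)); last lra.
rewrite lerD2l mulrAC ler_pdivrMr// ler_wpM2l//; first lra.
by rewrite (le_trans (ler_norm _))// lerDl.
Qed.

Section Main.
Context {R : realType} {I J : finType} {n m : nat}.
Variables (f : 'rV[R]_n -> R) (g : I -> 'rV[R]_n * 'rV[R]_m -> R) (v : J -> 'rV[R]_m -> R).
Hypotheses (g_C2 : forall i, C2 (g i)) (v_C2 : forall j, C2 (v j)).
Hypothesis Y_compact : compact (index_set v).

(** For each [w] in the index set, either g_i(xs, w) <> 0 or the differential is
    negative at (xs, w); both properties are open in (xs, w), and compactness gives a
    neighbourhood of [xs] that works for all [w]. *)
Lemma active_descent_near i xs eta :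
  (forall w, active_indices g v i xs w -> 'd (g i) (xs, w) (eta, 0) < 0) ->
  \forall z \near xs, forall w, index_set v w -> g i (z, w) = 0 ->
    'd (g i) (z, w) (eta, 0) < 0.
Proof.
move=> desc; have [C1g _] := g_C2 i.
apply: ((compact_near_coveringP _).1 Y_compact _ (nbhs xs)
  (fun z w => g i (z, w) = 0 -> 'd (g i) (z, w) (eta, 0) < 0)) => w Yw.
have cz : snd @ (nbhs (w, xs)) --> xs by exact: cvg_snd.
have cw : fst @ (nbhs (w, xs)) --> w by exact: cvg_fst.
have [gw|gw] := eqVneq (g i (xs, w)) 0.
  have ce : (fun _ : 'rV[R]_m * 'rV[R]_n => eta) @ nbhs (w, xs) --> eta by exact: cvg_cst.
  have c0 : (fun _ : 'rV[R]_m * 'rV[R]_n => 0 : 'rV[R]_m) @ nbhs (w, xs) --> (0 : 'rV[R]_m).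
    exact: cvg_cst.
  have dc : 'd (g i) (p.2, p.1) (eta, 0) @[p --> nbhs (w, xs)] --> 'd (g i) (xs, w) (eta, 0).
    exact: (diff_pair_cvg C1g cz cw ce c0).
  have : \forall p \near (w, xs), 'd (g i) (p.2, p.1) (eta, 0) < 0.
    by apply: (cvgr_lt _ dc); exact: desc.
  by apply: filterS => p dp _.
have gc : g i (p.2, p.1) @[p --> nbhs (w, xs)] --> g i (xs, w).
  exact: (C1_pair_cvg C1g cz cw).
have : \forall p \near (w, xs), g i (p.2, p.1) != 0 by exact: (cvgr_neq0 _ gc gw).
by apply: filterS => p + gp0; rewrite gp0 eqxx.
Qed.

(** Farkas' lemma for the family of all D_1 g_i(xs, w), which is finite because there
    are finitely many active indices. *)
Lemma stationary_or_descent xs : reduction_ansatz g v xs ->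
  (exists lambda : I -> 'rV[R]_m -> R,
    (forall i y, active_indices g v i xs y -> 0 <= lambda i y) /\
    0 = grad f xs + \sum_i \sum_(y \in active_indices g v i xs)
                lambda i y *: grad (fun z => g i (z, y)) xs) \/
  (exists eta, 'd f xs eta < 0 /\
    forall i w, active_indices g v i xs w -> 'd (g i) (xs, w) (eta, 0) <= 0).
Proof.
move=> ansatz; have Afin i : finite_set (active_indices g v i xs).
  exact: (active_indices_finite g_C2 v_C2 i Y_compact ansatz).
pose s := [seq (i, w) | i <- enum I,
  w <- finmap.enum_fset (fset_set (active_indices g v i xs))].
pose a (t : I * 'rV[R]_m) := grad (fun z => g t.1 (z, t.2)) xs.
have us : uniq s.
  apply: allpairs_uniq_dep; [exact: enum_uniq|by move=> i _; exact: finmap.fset_uniq|].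
  by move=> [i1 w1] [i2 w2] _ _ /= [-> ->].
have [[lam [lam0 lamE]]|[eta [aeta feta]]] := farkas a (- grad f xs) us.
  left; exists (fun i w => lam (i, w)); split=> [i w _|]; first exact: lam0.
  apply/esym/eqP; rewrite addrC addr_eq0; apply/eqP; rewrite lamE /s.
  rewrite big_allpairs_dep big_enum /=; apply: eq_bigr => i _.
  exact: fsbig_finite.
right; exists eta; split.
  by move: feta; rewrite -scaleN1r dotZl mulN1r oppr_gt0 dot_grad.
move=> i w Aw.
rewrite -(@diff_partial1 _ _ _ (g i)); last exact: g_diff.
rewrite -dot_grad; apply: (aeta (i, w)).
apply: allpairs_f_dep; first by rewrite mem_enum.
by rewrite in_fset_set// inE.
Qed.

Section Run.
Variables (x : nat -> 'rV[R]_n) (Yd : nat -> set 'rV[R]_m).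
Variables (y : I -> nat -> 'rV[R]_m) (mu : I -> nat -> J -> R).
Variables (yf : I -> nat -> 'rV[R]_n -> 'rV[R]_m).
Variables (muf : I -> nat -> 'rV[R]_n -> J -> R).
Hypothesis run : quADAPT f g v x Yd y mu yf muf.

Lemma discretization_finite k : finite_set (Yd k) /\ Yd k `<=` index_set v.
Proof.
elim: k => [|k [fk sk]]; first by split; [exact: quADAPT_finite0 run|exact: quADAPT_sub0 run].
rewrite (quADAPT_update run); split.
  by rewrite finite_setU; split => //; exact: finite_image finite_finset.
by move=> w [/sk//|[i _ <-]]; have [] := quADAPT_lower run i k.
Qed.

(** Pairing the KKT equation with [eta] leaves a negative number: the multiplier of a
    discretized constraint vanishes unless that constraint is active at [x k.+1]. *)
Lemma approx_KKT_descent k eta : approx_KKT f g v x Yd y mu yf muf k (x k.+1) ->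
  'd f (x k.+1) eta < 0 ->
  (forall i w, index_set v w -> g i (x k.+1, w) = 0 ->
     'd (g i) (x k.+1, w) (eta, 0) < 0) ->
  (forall i, 'd (gbar g v x y mu yf muf i k) (x k.+1) eta < 0) -> False.
Proof.
move=> [_ [alpha [beta [alphaP betaP stat]]]] feta geta gbeta.
have [Yfin Ysub] := discretization_finite k.+1.
move: stat => /(congr1 (dot^~ eta)); rewrite !dotDl dot_grad.
rewrite (@fsbig_finite _ _ _ _ (Ibar g v x y k)) ?dot_suml; last exact: finite_finset.
have -> : dot (0 : 'rV[R]_n) eta = 0 by rewrite dotC /dot big1// => a _; rewrite mxE mulr0.
set A := \sum_i _; set B := \sum_(i <- _) _ => E.
suff [A0 B0] : A <= 0 /\ B <= 0 by lra.
split.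
  apply: sumr_le0 => i _; rewrite fsbig_finite// dot_suml.
  rewrite big_seq; apply: sumr_le0 => w; rewrite in_fset_set// inE => Yw.
  have [al0 /eqP] := alphaP i w Yw; rewrite dotZl dot_grad diff_partial1; last exact: g_diff.
  rewrite mulf_eq0 => /orP[/eqP ->|/eqP gw]; first by rewrite mul0r.
  by apply: mulr_ge0_le0 => //; apply/ltW/geta => //; exact: Ysub.
rewrite /B big_seq; apply: sumr_le0 => i; rewrite in_fset_set ?inE; last exact: finite_finset.
move=> /betaP[be0 _]; rewrite dotZl dot_grad.
by apply: mulr_ge0_le0 => //; exact/ltW.
Qed.

(** The limit [ys] of the global solutions maximizes g_i(xs, .), because maximality
    passes to the limit.  The maximum is at most 0, as [y i k] belongs to the
    discretization for which [x k.+1] is feasible, and at least 0, as some index is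
    active at [xs].  This also makes [xs] feasible. *)
Lemma active_limit (U : set_system nat) xs i : UltraFilter U ->
  x @ U --> xs -> x k.+1 @[k --> U] --> xs ->
  (exists w, index_set v w /\ g i (xs, w) = 0) ->
  exists2 ys, y i @ U --> ys & active_indices g v i xs ys /\
    forall w, index_set v w -> g i (xs, w) <= 0.
Proof.
move=> UU xx xnext [w0 [Yw0 gw0]].
have [ys Yys yys] : exists2 p, index_set v p & y i @ U --> p.
  by apply: compact_ultra_cvg => // k; have [] := quADAPT_lower run i k.
have [C1g _] := g_C2 i.
have max_ys w : index_set v w -> g i (xs, w) <= g i (xs, ys).
  move=> Yw.
  have cw : (fun _ : nat => w) @ U --> w by exact: cvg_cst.
  have c1 : g i (x k, w) @[k --> U] --> g i (xs, w) by exact: (C1_pair_cvg C1g xx cw).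
  have c2 : g i (x k, y i k) @[k --> U] --> g i (xs, ys) by exact: (C1_pair_cvg C1g xx yys).
  apply: (ler_cvg_to c1 c2); apply: nearW => k.
  by have [_] := quADAPT_lower run i k; exact.
have ys0 : g i (xs, ys) <= 0.
  have c : g i (x k.+1, y i k) @[k --> U] --> g i (xs, ys) by exact: (C1_pair_cvg C1g xnext yys).
  apply: (cvgr_to_le c); apply: nearW => k.
  have [[+ _] _] := quADAPT_next run k; apply.
  by rewrite (quADAPT_update run); right; exists i.
exists ys => //; split=> [|w Yw]; last exact: le_trans (max_ys w Yw) ys0.
by split=> //; apply/eqP; rewrite eq_le ys0 -{1}gw0 max_ys.
Qed.

End Run.

End Main.

Unset Implicit Arguments.

Theorem theorem3p6 (R : realType) (I J : finType) (n m : nat)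
  (f : 'rV[R]_n -> R) (g : I -> 'rV[R]_n * 'rV[R]_m -> R)
  (v : J -> 'rV[R]_m -> R)
  (f_C2 : C2 f) (g_C2 : forall i, C2 (g i)) (v_C2 : forall j, C2 (v j))
  (Y_compact : compact (index_set v))
  (x : nat -> 'rV[R]_n) (Yd : nat -> set 'rV[R]_m)
  (y : I -> nat -> 'rV[R]_m) (mu : I -> nat -> J -> R)
  (yf : I -> nat -> 'rV[R]_n -> 'rV[R]_m)
  (muf : I -> nat -> 'rV[R]_n -> J -> R)
  (run : quADAPT f g v x Yd y mu yf muf)
  (xs : 'rV[R]_n) (x_cvg : x @ \oo --> xs)
  (ansatz : reduction_ansatz g v xs)
  (active : forall i, exists w, index_set v w /\ g i (xs, w) = 0)
  (Ibar_full : forall k, Ibar g v x y k = setT)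
  (emfcq : EMFCQ g v xs) :
  stationary_point f g v xs.
Proof.
have [U [UU ooU]] := ultraFilterLemma eventually_filter.
have xU : x @ U --> xs by move=> A /x_cvg; exact: ooU.
have xnextU : x k.+1 @[k --> U] --> xs.
  have xnext : [sequence x k.+1]_k @ \oo --> xs by rewrite cvg_shiftS.
  by move=> A /xnext; exact: ooU.
have lim i := active_limit g_C2 Y_compact run UU xU xnextU (active i).
split=> //; first by move=> i w Yw; have [ys _ [_]] := lim i; exact.
have [//|[eta [feta geta]]] := stationary_or_descent f g_C2 v_C2 Y_compact ansatz.
exfalso; have [xi xiP] := emfcq.
have [e e0 fe] := small_perturbation ('d f xs xi) feta.
pose d := eta + e *: xi.
have fd : 'd f xs d < 0 by rewrite /d linearD linearZ.
have gd i w : active_indices g v i xs w -> 'd (g i) (xs, w) (d, 0) < 0.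
  move=> Aw; rewrite -(@diff_partial1 _ _ _ (g i)); last exact: g_diff.
  have etaw : 'd (fun z => g i (z, w)) xs eta <= 0.
    by rewrite diff_partial1; [exact: geta|exact: g_diff].
  rewrite /d linearD linearZ /=; apply: (@le_lt_trans _ _ (0 + e * -1)).
    by apply: lerD => //; apply: ler_wpM2l; [exact: ltW|exact: xiP].
  by rewrite add0r mulrN1 oppr_lt0.
have near_f : \forall k \near U, 'd f (x k.+1) d < 0.
  have cd : (fun _ : nat => d) @ U --> d by exact: cvg_cst.
  have [C1f _] := f_C2.
  have c : 'd f (x k.+1) d @[k --> U] --> 'd f xs d by exact: (diff_cvg C1f xnextU cd).
  exact: (cvgr_lt _ c).
have near_g : \forall k \near U, forall i w, index_set v w -> g i (x k.+1, w) = 0 ->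
    'd (g i) (x k.+1, w) (d, 0) < 0.
  apply: filter_forall => i.
  exact: xnextU _ (active_descent_near g_C2 Y_compact (gd i)).
have near_gbar : \forall k \near U, forall i,
    'd (gbar g v x y mu yf muf i k) (x k.+1) d < 0.
  apply: filter_forall => i; have [ys yys [Ays _]] := lim i.
  have kkt k := quADAPT_multiplier run i k.
  have impl k : implicit_KKT g v i (x k) (y i k) (mu i k) (yf i k) (muf i k).
    by apply: (quADAPT_implicit run); rewrite Ibar_full.
  have c : 'd (gbar g v x y mu yf muf i k) (x k.+1) d @[k --> U] --> 'd (g i) (xs, ys) (d, 0).
    exact: (gbar_diff_cvg g_C2 v_C2 kkt impl xU xnextU yys (ansatz i ys Ays)).
  by apply: (cvgr_lt _ c); exact: gd.
have [k [[fk gk] gbk]] := filter_ex (filterI (filterI near_f near_g) near_gbar).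
exact: (approx_KKT_descent g_C2 run (quADAPT_next run k) fk gk gbk).
Qed.
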